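(* Let $0<\alpha<1$, $1<p<\infty$, $T>0$, $0\le\mu<p-1$, $0\le\gamma<p-1$, let $\omega(t)=t^\mu(T-t)^\gamma$ on $(0,T)$ be the Jacobi weight, and let $\nu=\max(\mu,\gamma)$. Then there exists a constant $C>0$ such that for every $y\in W^{2,p}_\omega(0,T)$, every integer $N\ge1$ with $\tau=T/N$ and $t_n=n\tau$, and every $1\le n\le N$, $$|D^\alpha y(t_n)-\delta_\tau^\alpha y(t_n)|\le C\,\tau^{2-\alpha-\frac{1+\nu}{p}}\,\|y\|_{W^{2,p}_\omega}.$$ In particular $C$ does not depend on $\tau$, $n$ or $y$.
   Context: For a weight (locally integrable function) $\omega:(0,T)\to[0,\infty)$, $L^p_\omega(0,T)$ has norm $\|y\|_{L^p_\omega}=\left(\int_0^T|y(t)|^p\omega(t)\,dt\right)^{1/p}$, and $W^{s,p}_\omega(0,T)=\{y\in L^p_\omega(0,T): y',\dots,y^{(s)}\in L^p_\omega(0,T)\}$ (weak derivatives) with norm $\|y\|_{W^{s,p}_\omega}=\left(\int_0^T\left(\sum_{k=0}^s|y^{(k)}(t)|^p\right)\omega(t)\,dt\right)^{1/p}$. Functions $y\in W^{2,p}_\omega(0,T)$ are identified with their continuously differentiable representatives on $[0,T]$ (with $y'$ absolutely continuous). The Caputo derivative of order $\alpha\in(0,1)$ is $D^\alpha y(t)=\frac1{\Gamma(1-\alpha)}\int_0^t\frac{y'(s)}{(t-s)^\alpha}\,ds$. The L1 scheme on the grid $t_n=n\tau$, $n\ge1$, is $$\delta_\tau^\alpha y(t_n)=\frac{\tau^{-\alpha}}{\Gamma(2-\alpha)}\left(y(t_n)-b_{n-1}y(0)-\sum_{i=1}^{n-1}(b_{n-i-1}-b_{n-i})y(t_i)\right),\qquad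 b_i=(i+1)^{1-\alpha}-i^{1-\alpha}.$$ *)

(* Defs.v *)
(* MathComp-Analysis, over an arbitrary [R : realType]. *)
From mathcomp Require Export all_boot all_order all_algebra.
From mathcomp Require Export all_classical all_reals all_analysis.

Set Implicit Arguments.
Unset Strict Implicit.
Unset Printing Implicit Defensive.

Import Order.TTheory GRing.Theory Num.Theory.
Import numFieldNormedType.Exports.

Local Open Scope classical_set_scope.
Local Open Scope ring_scope.

(** * Weak derivatives on (0,T) *)

(* C_c^oo(0,T), each test function being extended by zero to the whole line. *)
Definition test_function (R : realType) (T : R) (phi : R -> R) : Prop :=
  [/\ forall (k : nat) (x : R), derivable phi^`(k)%classic x 1,
      compact (closure [set x | phi x != 0]) &
      closure [set x | phi x != 0] `<=` `]0, T[].

Definition is_weak_derivative (R : realType) (T : R) (k : nat)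
    (y g : R -> R) : Prop :=
  [/\ locally_integrable `]0, T[ y, locally_integrable `]0, T[ g &
      forall phi : R -> R, test_function T phi ->
        \int[lebesgue_measure]_(x in `]0, T[) (y x * phi^`(k)%classic x) =
        (-1) ^+ k * \int[lebesgue_measure]_(x in `]0, T[) (g x * phi x)].

(* A weak derivative is determined only almost everywhere: one is chosen (0 if
   there is none).  The derivative of order 0 is [y] itself. *)
Definition weak_derivative (R : realType) (T : R) (k : nat) (y : R -> R) :
    R -> R :=
  if k is 0%N then y else xget (cst 0) [set g | is_weak_derivative T k y g].

(** * Weighted Lebesgue and Sobolev spaces on (0,T) *)

Definition in_weighted_Lp (R : realType) (T : R) (w : R -> R) (p : R)
    (y : R -> R) : Prop :=
  measurable_fun `]0, T[ y /\
  (\int[lebesgue_measure]_(t in `]0%R, T[) (`|y t| `^ p * w t)%R%:E < +oo)%E.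

Definition in_weighted_Sobolev (R : realType) (T : R) (w : R -> R) (s : nat)
    (p : R) (y : R -> R) : Prop :=
  in_weighted_Lp T w p y /\
  forall k : nat, (1 <= k <= s)%N ->
    (exists g : R -> R, is_weak_derivative T k y g) /\
    in_weighted_Lp T w p (weak_derivative T k y).

Definition weighted_Sobolev_norm (R : realType) (T : R) (w : R -> R) (s : nat)
    (p : R) (y : R -> R) : R :=
  (\int[lebesgue_measure]_(t in `]0, T[)
     ((\sum_(0 <= k < s.+1) `|weak_derivative T k y t| `^ p) * w t)) `^ p^-1.

Definition jacobi_weight (R : realType) (T mu gamma t : R) : R :=
  t `^ mu * (T - t) `^ gamma.

(* C^1 on the closed interval: [y] is continuous up to the boundary and its
   derivative on the open interval extends continuously to [[a, b]].  Values of
   [y] outside [[a, b]] are irrelevant. *)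
Definition C1_on_itv (R : realType) (a b : R) (y : R -> R) : Prop :=
  derivable_oo_LRcontinuous y a b /\
  exists2 z : R -> R,
    {within `[a, b], continuous z} & {in `]a, b[, y^`()%classic =1 z}.

(** * Caputo derivative and L1 scheme *)

Definition Gamma (R : realType) (x : R) : R :=
  \int[lebesgue_measure]_(t in `]0, +oo[) (t `^ (x - 1) * expR (- t)).

Definition caputo (R : realType) (alpha : R) (y : R -> R) (t : R) : R :=
  (Gamma (1 - alpha))^-1 *
  \int[lebesgue_measure]_(s in `]0, t[) (y^`()%classic s / (t - s) `^ alpha).

Definition L1_coef (R : realType) (alpha : R) (i : nat) : R :=
  i.+1%:R `^ (1 - alpha) - i%:R `^ (1 - alpha).

(* Value at the grid point [n * tau], for [n >= 1]. *)
Definition L1_scheme (R : realType) (alpha tau : R) (y : R -> R) (n : nat) : R :=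
  let b := L1_coef alpha in
  tau `^ (- alpha) / Gamma (2 - alpha) *
  (y (n%:R * tau) - b n.-1 * y 0
   - \sum_(1 <= i < n) (b (n - i - 1)%N - b (n - i)%N) * y (i%:R * tau)).

(* Main.v *)
(* The modulus of continuity of y' on a grid cell is controlled by the L^1
   norm of y'' there, hence by Hoelder's inequality by E = K tau^(1 - (1 +
   nu) / p) times the Sobolev norm, because the weight to the power -1/(p -
   1) is integrable with singularities of order at most nu / (p - 1). The L1
   scheme replaces y' on each cell by its mean value m, so that |y' - m| <= E
   and y' - m has mean zero. The cell adjacent to t_n contributes at most E
   tau^(1 - alpha) / (1 - alpha). On every other cell the zero mean allows
   one to subtract from the kernel (t_n - s)^(- alpha) its value at the left
   end point; the remaining oscillations of the kernel telescope and add up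
   to at most tau^(- alpha), whence a total of E tau^(1 - alpha). Summing |y'
   - m| against the kernel without this cancellation would lose the rate for
   small alpha. *)

(* The obstacle is the very first step. [C1_on_itv] provides only a continuous y', and the second
   derivative is a function picked by choice, tied to y through integrals against test functions
   alone; the inequality |y'(b) - y'(a)| <= int |y''| has to be extracted from that identity. A
   smoothed indicator of [a, b] serves as test function, which is why smooth steps are built at the
   outset. The rate arises in Hoelder's inequality as tau^(1 - nu / (p - 1)) raised to the power 1 -
   1 / p; for this the integral of w^(-1 / (p - 1)) must be bounded uniformly over all intervals of
   length at most tau, wherever they lie in (0, T). Finally, the Caputo derivative is normalised by
   Gamma(1 - alpha) and the scheme by Gamma(2 - alpha), so comparing them takes the functional
   equation of Gamma. *)
Require Import Defs.
From mathcomp Require Import ring lra measurable_realfun.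
Import Order.TTheory GRing.Theory Num.Theory.
Import numFieldNormedType.Exports.
Local Open Scope classical_set_scope.
Local Open Scope ring_scope.
Set Implicit Arguments.
Unset Strict Implicit.

(** * Smooth step functions *)

Section SmoothStep.
Context {R : realType}.
Implicit Types (f g : R -> R) (P : {poly R}).

(** Each derivative is carried as a witness, so that closure under sums, products and inverses goes
    by induction on [n], without formulas for iterated derivatives. Smoothness is
    [ndifferentiable n f] for all [n]. *)
Fixpoint ndifferentiable (n : nat) f : Prop :=
  if n is m.+1 then
    exists2 df : R -> R, forall x : R, is_derive x 1 f (df x) & ndifferentiable m df
  else True.

Lemma is_derive_derive1 f (df : R -> R) :
  (forall x : R, is_derive x 1 f (df x)) -> f^`()%classic = df.
Proof.
by move=> fdf; apply/funext => x; rewrite derive1E; have [_ ->] := fdf x.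
Qed.

Lemma ndifferentiable_derivable f : (forall n, ndifferentiable n f) ->
  forall k x, derivable f^`(k)%classic x 1.
Proof.
move=> + k; elim: k f => [|k IH] f smf x.
  by have [df fdf _] := smf 1; rewrite derive1n0; have [] := fdf x.
rewrite derive1Sn; apply: IH => n.
by have [df fdf Ddf] := smf n.+1; rewrite (is_derive_derive1 fdf).
Qed.

Lemma ndifferentiable_cst n (c : R) : ndifferentiable n (fun=> c).
Proof.
elim: n c => //= n IH c; exists (fun=> 0) => // x; exact: is_derive_cst.
Qed.

Lemma ndifferentiableW n f : ndifferentiable n.+1 f -> ndifferentiable n f.
Proof.
elim: n f => // n IH f [df fdf /IH Ddf]; by exists df.
Qed.

Lemma ndifferentiableD n f g : ndifferentiable n f -> ndifferentiable n g ->
  ndifferentiable n (fun x => f x + g x).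
Proof.
elim: n f g => //= n IH f g [df fdf Df] [dg gdg Dg].
exists (fun x => df x + dg x); last exact: IH.
by move=> x; exact: is_deriveD.
Qed.

Lemma ndifferentiableM n f g : ndifferentiable n f -> ndifferentiable n g ->
  ndifferentiable n (fun x => f x * g x).
Proof.
elim: n f g => //= n IH f g Sf Sg.
have [df fdf Df] := Sf; have [dg gdg Dg] := Sg.
exists (fun x => f x * dg x + g x * df x).
  by move=> x; exact: is_deriveM.
by apply: ndifferentiableD; apply: IH => //; exact: ndifferentiableW.
Qed.

(** The derivative -f'/f^2 contains 1/f again, but one order of differentiability lower, where the
    induction hypothesis applies. *)
Lemma ndifferentiableV n f : (forall x, f x != 0) ->
  ndifferentiable n f -> ndifferentiable n (fun x => (f x)^-1).
Proof.
move=> f0; elim: n => //= n IH Sf; have [df fdf Df] := Sf.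
have If := IH (ndifferentiableW Sf).
exists (fun x => (-1 * ((f x)^-1 * (f x)^-1)) * df x).
  move=> x; have dV := is_deriveV (f0 x) (fdf x); apply: is_derive_eq dV _.
  by rewrite /GRing.scale/=; field.
do 2 (apply: ndifferentiableM => //).
  exact: ndifferentiable_cst.
exact: ndifferentiableM.
Qed.

Lemma ndifferentiable_affine n f (a b : R) : ndifferentiable n f ->
  ndifferentiable n (fun x => f (a * x + b)).
Proof.
elim: n f => //= n IH f [df fdf Df].
exists (fun x => df (a * x + b) * a); last first.
  by apply: ndifferentiableM; [exact: IH|exact: ndifferentiable_cst].
move=> x; have dab : is_derive x 1 (fun t : R => a * t + b) a.
  apply: is_derive_eq.
  by rewrite addr0 /GRing.scale/= mulr1.
exact: (@is_derive1_comp R f (fun t => a * t + b) x _ _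
          (fdf (a * x + b)) dab).
Qed.

(* The derivative of a function of this form is again of this form, with [P]
   replaced by X^2 (P - P'): one differentiability statement gives smoothness. *)
Definition flat P (x : R) := if 0 < x then P.[x^-1] * expR (- x^-1) else 0.

(** A single term of the exponential series gives exp(1/x) >= x^-(i+2) / (i+2)!, so that x^-i
    exp(-1/x) <= (i+2)! x^2 for every monomial. The square leaves one power of x to spare in the
    difference quotient at 0. *)
Lemma flat_bound P :
  exists2 C : R, 0 <= C & forall x : R, 0 < x <= 1 -> `|flat P x| <= C * x ^+ 2.
Proof.
exists (\sum_(i < size P) `|P`_i| * (i.+2)`!%:R).
  by apply: sumr_ge0 => i _; rewrite mulr_ge0.
move=> x /andP[x0 x1]; rewrite /flat x0 horner_coef mulr_suml mulr_suml.
apply: (le_trans (ler_norm_sum _ _ _)); apply: ler_sum => i _.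
rewrite !normrM -!mulrA ler_wpM2l//.
rewrite ger0_norm; last by rewrite exprn_ge0// invr_ge0 ltW.
rewrite ger0_norm; last exact: expR_ge0.
have xi0 : 0 <= x^-1 by rewrite invr_ge0 ltW.
have := expR_ge1Dxn i.+1 xi0; set e := expR x^-1 => He.
have e0 : 0 < e by exact: expR_gt0.
rewrite expRN -/e ler_pdivrMr//.
have : x^-1 ^+ i.+2 / i.+2`!%:R <= e by lra.
rewrite ler_pdivrMr ?ltr0n ?fact_gt0// => H.
rewrite (_ : x^-1 ^+ i = x^-1 ^+ i.+2 * x ^+ 2); last first.
  by rewrite -addn2 exprD -mulrA -exprMn mulVf ?gt_eqF// expr1n mulr1.
rewrite [leRHS](_ : _ = (e * i.+2`!%:R) * x ^+ 2); last by ring.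
by rewrite ler_wpM2r// exprn_ge0// ltW.
Qed.

(** Away from 0 this is the chain rule, the factor X^2 coming from the derivative of 1/x. At 0 the
    difference quotient is at most C |h| by [flat_bound]. *)
Lemma is_derive_flat P (x : R) :
  is_derive x 1 (flat P) (flat ('X ^+ 2 * (P - P^`())) x).
Proof.
have [x0|x0|->] := ltgtP x 0.
- rewrite [flat _ x]/flat ltNge (ltW x0)/=.
  have d0 : is_derive x 1 (fun=> 0 : R) 0 by exact: is_derive_cst.
  apply: near_eq_is_derive d0.
  near=> t; rewrite /flat ifF//; apply/negbTE; rewrite -leNgt ltW//.
  by near: t; exact: lt_nbhsl.
- have xN0 : x != 0 by rewrite gt_eqF.
  have dV : is_derive x 1 (fun t : R => t^-1) (- x ^- 2).
    by apply: is_derive_eq (is_deriveV xN0 (is_derive_id x 1)) _;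
      rewrite /GRing.scale/= mulr1.
  have dP : is_derive x 1 (fun t : R => P.[t^-1]) (P^`().[x^-1] * - x ^- 2).
    exact: (@is_derive1_comp R (horner P) (fun t : R => t^-1) x _ _
            (is_derive_poly P x^-1) dV).
  have dE : is_derive x 1 (fun t : R => expR (- t^-1))
      (expR (- x^-1) * (x ^- 2)).
    have dN := is_deriveN dV; rewrite opprK in dN.
    exact: (@is_derive1_comp R expR (fun t : R => - t^-1) x _ _
            (is_derive_expR (- x^-1)) dN).
  have dF := is_deriveM dP dE.
  have := @near_eq_is_derive R _ _ _ (flat P) x 1 _ _ dF.
  have -> : flat ('X^2 * (P - P^`())) x =
      P.[x^-1] *: (expR (- x^-1) * x ^- 2) +
      expR (- x^-1) *: (P^`().[x^-1] * - x ^- 2).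
    by rewrite /flat x0 !hornerE /= /GRing.scale/= exprVn; ring.
  apply; near=> t; rewrite /flat ifT//.
  by near: t; exact: lt_nbhsr.
- have [C C0 PC] := flat_bound P.
  have Ch : C * `|h| @[h --> (0 : R)^'] --> 0.
    have h0 : `|h| @[h --> (0 : R)^'] --> `|0 : R|.
      by apply: cvg_norm; exact: cvg_within.
    rewrite normr0 in h0.
    by have := cvgMl_tmp (a := C) h0; rewrite mulr0; exact.
  have d0 : (fun h : R => h^-1 *: ((flat P \o shift 0) (h *: 1) - flat P 0))
      @ 0^' --> (0 : R).
    apply: (@squeeze_cvgr _ _ _ _ (fun h => - (C * `|h|)) (fun h => C * `|h|)).
    + near=> h; rewrite -ler_norml /= {2}/flat ltxx subr0 addr0 /GRing.scale/= mulr1.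
      have h0 : h != 0 by near: h; exact: nbhs_dnbhs_neq.
      have h1 : `|h| <= 1.
        near: h; exact: dnbhs0_le.
      have [hn|hp] := leP h 0.
        by rewrite /flat ltNge hn/= mulr0 normr0 mulr_ge0.
      rewrite normrM normfV ler_pdivrMl ?normr_gt0//.
      rewrite (gtr0_norm hp) in h1 *.
      by rewrite mulrCA -expr2; apply: PC; rewrite hp.
    + by have := cvgN Ch; rewrite oppr0; exact.
    + exact: Ch.
  have -> : flat ('X^2 * (P - P^`())) 0 = 0 by rewrite /flat ltxx.
  by apply: DeriveDef; [apply/cvg_ex; exists 0|exact: cvg_lim d0].
Unshelve. all: by end_near.
Qed.

Lemma ndifferentiable_flat n P : ndifferentiable n (flat P).
Proof.
elim: n P => //= n IH P; exists (flat ('X ^+ 2 * (P - P^`()))); last exact: IH.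
exact: is_derive_flat.
Qed.

(** The classical quotient f(x) / (f(x) + f(1 - x)) with f(x) = exp(-1/x) for x > 0 and f(x) = 0
    otherwise. The denominator never vanishes, since x or 1 - x is positive. *)
Lemma smooth_step : exists S : R -> R, [/\ forall n, ndifferentiable n S,
  forall x, 0 <= S^`()%classic x, forall x : R, x <= 0 -> S x = 0 &
  forall x : R, 1 <= x -> S x = 1].
Proof.
pose f := flat 1; pose f1 := fun x => f ((-1) * x + 1).
have f_ge0 x : 0 <= f x.
  by rewrite /f /flat; case: ifP => // _; rewrite hornerE mul1r expR_ge0.
have f_gt0 (x : R) : 0 < x -> 0 < f x.
  by move=> x0; rewrite /f /flat x0 hornerE mul1r expR_gt0.
have f_eq0 (x : R) : x <= 0 -> f x = 0.
  by move=> x0; rewrite /f /flat ltNge x0.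
have D_gt0 x : 0 < f x + f1 x.
  have [x0|x0] := ltP 0 x; first by rewrite ltr_wpDr ?f_ge0 ?f_gt0.
  by rewrite ltr_wpDl ?f_ge0// f_gt0//; lra.
have D_neq0 x : f x + f1 x != 0 by rewrite gt_eqF.
exists (fun x => f x * (f x + f1 x)^-1); split.
- move=> n; apply: ndifferentiableM; first exact: ndifferentiable_flat.
  apply: ndifferentiableV => //; apply: ndifferentiableD.
    exact: ndifferentiable_flat.
  by apply: ndifferentiable_affine; exact: ndifferentiable_flat.
- move=> x; pose df := flat ('X^2 * (1 - 1^`())).
  have df_ge0 t : 0 <= df t.
    rewrite /df /flat; case: ifP => // t0.
    rewrite -polyC1 derivC !hornerE /= mulr_ge0 ?expR_ge0//.
    by rewrite subr0 mulr1 exprn_ge0// invr_ge0 ltW.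
  have fdf : is_derive x 1 f (df x) by exact: is_derive_flat.
  have dab : is_derive x 1 (fun t : R => (-1) * t + 1) (-1).
    apply: is_derive_eq.
    by rewrite addr0 /GRing.scale/= mulr1.
  have f1df : is_derive x 1 f1 (df ((-1) * x + 1) * -1).
    exact: (@is_derive1_comp R f (fun t => (-1) * t + 1) x _ _
          (is_derive_flat 1 _) dab).
  have dD := is_deriveD fdf f1df.
  have dS := is_deriveM fdf (@is_deriveV R (f + f1) x _ _ (D_neq0 x) dD).
  rewrite derive1E (@derive_val _ _ _ _ _ _ _ dS) /GRing.scale/= -/(f1 x).
  set d := f x + f1 x.
  (* In the quotient rule the terms f(x) f'(x) cancel, leaving only nonnegative products. *)
  rewrite (_ : _ + _ = (d^-1)^+2 * (df x * f1 x + f x * df ((-1) * x + 1))).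
    by apply: mulr_ge0 (sqr_ge0 _) _; apply: addr_ge0; apply: mulr_ge0;
      [exact: df_ge0|exact: f_ge0|exact: f_ge0|exact: df_ge0].
  have d0 : d != 0 := D_neq0 x.
  rewrite (_ : (f + f1) x = d)//.
  rewrite (_ : f1 x = d - f x); last by rewrite /d; ring.
  by field.
- by move=> x x0; rewrite f_eq0 ?mul0r.
- move=> x x1; rewrite [f1 x]f_eq0 ?addr0 ?divff// ?gt_eqF ?f_gt0//; lra.
Qed.

End SmoothStep.

(** * Second weak derivatives *)

Section IntegrableReal.
Context d (T : measurableType d) (R : realType).
Variables (mu : {measure set T -> \bar R}) (D : set T).
Hypothesis mD : measurable D.
Implicit Types f g u k : T -> R.

Lemma integrable_EFinB f g : mu.-integrable D (EFin \o f) ->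
  mu.-integrable D (EFin \o g) ->
  mu.-integrable D (EFin \o (fun x => f x - g x)).
Proof.
move=> fi gi; have := integrableB mD fi gi.
by apply: eq_integrable => // x _ /=; rewrite EFinB.
Qed.

Lemma integrable_EFin_norm f : mu.-integrable D (EFin \o f) ->
  mu.-integrable D (EFin \o (fun x => `|f x|)).
Proof.
move=> fi; have := integrable_norm fi.
by apply: eq_integrable => // x _ /=.
Qed.

Lemma bounded_integrableM u k (E : R) :
  measurable_fun D u -> (forall x, D x -> `|u x| <= E) ->
  mu.-integrable D (EFin \o k) ->
  mu.-integrable D (EFin \o (fun x => u x * k x)).
Proof.
move=> mf uE ik.
have iEk : mu.-integrable D (EFin \o (fun x => E * k x)).
  have := integrableZl mD E ik.
  by apply: eq_integrable => // x _ /=; rewrite EFinM.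
apply: le_integrable iEk => //.
  apply/measurable_EFinP; apply: measurable_funM => //.
  by apply/measurable_EFinP; case/integrableP: ik.
move=> x Dx; rewrite /= lee_fin !normrM ler_wpM2r//.
exact: le_trans (uE x Dx) (ler_norm E).
Qed.

Lemma le_normr_RintegralM u k (E : R) :
  measurable_fun D u -> (forall x, D x -> `|u x| <= E) ->
  mu.-integrable D (EFin \o k) ->
  `|\int[mu]_(x in D) (u x * k x)| <= E * \int[mu]_(x in D) `|k x|.
Proof.
move=> mf uE ik; have iuk := bounded_integrableM mf uE ik.
apply: le_trans (le_normr_Rintegral mD iuk) _.
rewrite -RintegralZl//; last exact: integrable_EFin_norm.
apply: le_Rintegral => //; first exact: integrable_EFin_norm.
  apply: (@bounded_integrableM (fun=> E) (fun x => `|k x|) `|E|) => //.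
  exact: integrable_EFin_norm.
by move=> x Dx; rewrite normrM ler_wpM2r ?uE.
Qed.

End IntegrableReal.

(** * The increment of the classical y' against the weak second derivative *)

Section WeakSecondDerivative.
Context {R : realType}.
Local Notation mu := (@lebesgue_measure R).
Implicit Types (y g u s : R -> R).

Lemma ndifferentiable_derive1 n s : ndifferentiable n.+1 s ->
  ndifferentiable n s^`()%classic.
Proof. by move=> [ds sds Dds]; rewrite (is_derive_derive1 sds). Qed.

Lemma ndifferentiable1P n s : ndifferentiable n.+1 s ->
  forall x : R, derivable s x 1.
Proof. by move=> [ds sds _] x; have [] := sds x. Qed.

Lemma ndifferentiable_continuous n s : ndifferentiable n.+1 s -> continuous s.
Proof.
move=> /ndifferentiable1P ds x; apply: differentiable_continuous.
exact/derivable1_diffP.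
Qed.

Lemma derivable_oo_LRcontinuousT s (a b : R) : (forall x : R, derivable s x 1) ->
  derivable_oo_LRcontinuous s a b.
Proof.
move=> ds; have cs x : {for x, continuous s}.
  by apply: differentiable_continuous; exact/derivable1_diffP.
by split=> //; [apply: cvg_at_right_filter|apply: cvg_at_left_filter]; exact: cs.
Qed.

Lemma derive1_eq_near s (c x : R) : (\near x, s x = c) -> s^`()%classic x = 0.
Proof.
move=> sc; rewrite derive1E (@near_eq_derive _ _ _ _ (fun=> c)) ?derive_cst//.
Qed.

(** A smoothed Heaviside function; its derivative is a nonnegative bump of mass 1 carried by
    [c, d]. *)
Definition is_step s (c d : R) := [/\ forall n, ndifferentiable n s,
  forall x, 0 <= s^`()%classic x, forall x : R, x <= c -> s x = 0 &
  forall x : R, d <= x -> s x = 1].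

Lemma step_exists (c d : R) : c < d -> exists s, is_step s c d.
Proof.
move=> cd; have [S [S1 S2 S3 S4]] := smooth_step (R := R).
have dc0 : 0 < d - c by rewrite subr_gt0.
pose k := (d - c)^-1; have k0 : 0 < k by rewrite invr_gt0.
exists (fun x => S (k * x + - (k * c))); split.
- by move=> n; exact: ndifferentiable_affine.
- move=> x; have dab : is_derive x 1 (fun t : R => k * t + - (k * c)) k.
    apply: is_derive_eq.
    by rewrite subr0 /GRing.scale/= mulr1.
  have [dS SdS _] := S1 1.
  rewrite derive1E (@derive_val _ _ _ _ _ _ _ (@is_derive1_comp R S
    (fun t => k * t + - (k * c)) x _ _ (SdS _) dab)).
  by rewrite mulr_ge0 ?(ltW k0)// -(is_derive_derive1 SdS).
- by move=> x xc; apply: S3; rewrite subr_le0 ler_pM2l.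
- move=> x dx; apply: S4; rewrite -mulrBr -(@mulVf _ (d - c)) ?gt_eqF//.
  by rewrite ler_pM2l// lerB.
Qed.

Lemma step_derive1_eq0 s (c d x : R) : is_step s c d -> x < c \/ d < x ->
  s^`()%classic x = 0.
Proof.
move=> [_ _ s0 s1] [xc|dx].
- apply: (@derive1_eq_near _ 0); near=> t; apply: s0; apply: ltW.
  by near: t; exact: lt_nbhsl.
- apply: (@derive1_eq_near _ 1); near=> t; apply: s1; apply: ltW.
  by near: t; exact: lt_nbhsr.
Unshelve. all: by end_near. Qed.

Lemma step_bounds s (c d x : R) : c <= d -> is_step s c d -> 0 <= s x <= 1.
Proof.
move=> cd [s1 s2 s3 s4].
have ds : forall x : R, derivable s x 1 by exact: (ndifferentiable1P (s1 1)).
have ndec a b : a <= b -> s a <= s b.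
  move=> ab; apply: (ger0_derive1_le_cc (a := a) (b := b)) => //.
  - by apply: continuous_subspaceT; exact: (ndifferentiable_continuous (s1 1)).
  - by rewrite in_itv/= lexx.
  - by rewrite in_itv/= lexx andbT.
have -> : 0 = s (Num.min x c) by rewrite s3// ge_min lexx orbT.
have -> : 1 = s (Num.max x d) by rewrite s4// le_max lexx orbT.
by rewrite !ndec ?ge_min ?le_max ?lexx.
Qed.

Lemma Rintegral_derive1 s (a b : R) : a < b -> ndifferentiable 2 s ->
  \int[mu]_(x in `[a, b]) s^`()%classic x = s b - s a.
Proof.
move=> ab Ds; rewrite /Rintegral (@continuous_FTC2 _ _ s)//.
- apply: continuous_subspaceT; apply: ndifferentiable_continuous.
  exact: ndifferentiable_derive1 Ds.
- by apply: derivable_oo_LRcontinuousT; exact: ndifferentiable1P Ds.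
Qed.

Lemma integrable_segment u (a b : R) : {within `[a, b], continuous u} ->
  mu.-integrable `[a, b] (EFin \o u).
Proof.
move=> cu; apply: continuous_compact_integrable => //; exact: segment_compact.
Qed.

Lemma within_continuousM u s (A : set R) : {within A, continuous u} ->
  {within A, continuous s} -> {within A, continuous (fun x => u x * s x)}.
Proof.
move=> cu cs x; apply: cvgM; [exact: cu|exact: cs].
Qed.

(** Integrating against the bump s' takes a weighted mean of u over [c, d], which stays within e of
    v if u does. *)
Lemma step_average u s (A B c d v e : R) : A < c -> c < d -> d < B ->
  is_step s c d -> {within `[A, B], continuous u} ->
  (forall x, c <= x <= d -> `|u x - v| <= e) ->
  `|\int[mu]_(x in `[A, B]) (u x * s^`()%classic x) - v| <= e.
Proof.
move=> Ac cd dB ss cu uve; have [s1 s2 s3 s4] := ss.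
have AB : A < B by rewrite (lt_trans Ac)// (lt_trans cd).
have cs' : {within `[A, B], continuous s^`()%classic}.
  apply: continuous_subspaceT; apply: (@ndifferentiable_continuous 0).
  exact: (ndifferentiable_derive1 (s1 2)).
have Is' := integrable_segment cs'.
have I1 : \int[mu]_(x in `[A, B]) s^`()%classic x = 1.
  by rewrite Rintegral_derive1// s4 ?(ltW dB)// s3 ?subr0// ltW.
have Ius := integrable_segment (within_continuousM cu cs').
have mk (k : R) : mu.-integrable `[A, B] (EFin \o (fun x => k * s^`()%classic x)).
  apply: integrable_segment; apply: within_continuousM => //.
  by apply: continuous_subspaceT => x; exact: cst_continuous.
rewrite -[v in X in X <= _]mulr1 -{1}I1 -RintegralZl// -RintegralB//.
have Ic : mu.-integrable `[A, B]
    (EFin \o (fun x => u x * s^`()%classic x - v * s^`()%classic x)).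
  exact: integrable_EFinB.
apply: (le_trans (le_normr_Rintegral _ Ic)) => //.
rewrite -[leRHS]mulr1 -I1 -RintegralZl//; apply: le_Rintegral => //.
  exact: integrable_EFin_norm.
move=> x _; rewrite -mulrBl normrM (ger0_norm (s2 x)).
have [xc|cx] := ltP x c.
  by rewrite (step_derive1_eq0 ss) ?mulr0//; left.
have [dx|xd] := ltP d x.
  by rewrite (step_derive1_eq0 ss) ?mulr0//; right.
by rewrite ler_wpM2r// uve// cx.
Qed.

Lemma test_functionP (T a b : R) (phi : R -> R) : 0 < a -> b < T ->
  (forall n, ndifferentiable n phi) ->
  (forall x, x \notin `[a, b] -> phi x = 0) -> test_function T phi.
Proof.
move=> a0 bT Dphi phi0.
have sub : closure [set x | phi x != 0] `<=` `[a, b].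
  rewrite closureE; apply: smallest_sub; first exact: interval_closed.
  by move=> x /=; apply: contraNT => /phi0/eqP.
split; first exact: ndifferentiable_derivable.
- apply: subclosed_compact sub; last exact: segment_compact.
  exact: closed_closure.
- apply: subset_trans sub _ => x /=; rewrite !in_itv/= => /andP[ax xb].
  by rewrite (lt_le_trans a0)//= (le_lt_trans xb).
Qed.

Lemma Rintegral_supp (A B : set R) (f : R -> R) : A `<=` B ->
  (forall x, B x -> ~ A x -> f x = 0) ->
  \int[mu]_(x in B) f x = \int[mu]_(x in A) f x.
Proof.
move=> AB f0; rewrite Rintegral_mkcond [RHS]Rintegral_mkcond.
congr Rintegral; apply/funext => x; rewrite !patchE.
have [xA|xA] := boolP (x \in A); first by rewrite mem_set//; apply/AB/set_mem.
by case: ifPn => // /set_mem xB; apply: f0 => // /mem_set; exact/negP.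
Qed.

Lemma locally_integrable_itv (A : set R) (g : R -> R) (a b : R) :
  locally_integrable A g -> `[a, b] `<=` A -> mu.-integrable `[a, b] (EFin \o g).
Proof.
move=> [mg oA gfin] abA; apply/integrableP; split; last first.
  exact: gfin abA (@segment_compact R a b).
apply/measurable_EFinP; apply: measurable_funS mg => //.
exact: open_measurable.
Qed.

Lemma C1_derive1_continuous (T : R) (y : R -> R) : C1_on_itv 0 T y ->
  {in `]0, T[, continuous y^`()%classic}.
Proof.
move=> [_ [z cz yz]] x x0T.
have T0 : 0 < T by move: x0T; rewrite in_itv/= => /andP[]; exact: lt_trans.
have czx : {for x, continuous z}.
  by have := cz; rewrite continuous_within_itvP// => -[cz' _ _]; exact: cz'.
have dyz : {near x, y^`()%classic =1 z}.
  by near=> t; apply: yz; near: t; apply: near_in_itvoo.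
rewrite /prop_for /continuous_at (yz _ x0T); apply: cvg_trans czx.
by apply: near_eq_cvg; near do apply/esym.
Unshelve. all: by end_near. Qed.

(** A smoothed indicator phi of [a, b] is tested. As |phi| <= 1 and phi lives on [a, b], the side
    with g is at most the integral of |g|; one integration by parts turns the other side into minus
    the integral of y' phi', which is y'(b) - y'(a) up to an arbitrary e. *)
Lemma dist_derive1_le (T a b : R) y g : C1_on_itv 0 T y ->
  is_weak_derivative T 2 y g -> 0 < a -> a < b -> b < T ->
  `|y^`()%classic b - y^`()%classic a| <= \int[mu]_(x in `[a, b]) `|g x|.
Proof.
move=> C1y [_ locg yg] a0 ab bT; have [yLR _] := C1y.
set dy := y^`()%classic.
(* On the slightly larger [A, B] the end points lie strictly outside [a, b], where phi' vanishes:
   the integration by parts then has no boundary terms. *)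
pose A := a / 2; pose B := (b + T) / 2.
have A0 : 0 < A by rewrite divr_gt0.
have Aa : A < a by rewrite /A; lra.
have bB : b < B by rewrite /B; lra.
have BT : B < T by rewrite /B; lra.
have AB : A < B by lra.
have ABT : `[A, B] `<=` `]0, T[.
  move=> x /=; rewrite !in_itv/= => /andP[Ax xB].
  by rewrite (lt_le_trans A0)//= (le_lt_trans xB).
have cdy : {in `]0, T[, continuous dy} by exact: C1_derive1_continuous C1y.
have cdyAB : {within `[A, B], continuous dy}.
  apply: continuous_in_subspaceT => x /set_mem xAB; apply: cdy.
  exact: ABT.
have dyAB : derivable_oo_LRcontinuous y A B.
  have cy x : x \in `]0, T[ -> {for x, continuous y}.
    case: yLR => dy' _ _ /dy' dyx.
    by apply: differentiable_continuous; exact/derivable1_diffP.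
  have [dy' _ _] := yLR.
  split.
  - move=> x xAB; apply: dy'; apply: ABT; exact: subset_itv_oo_cc xAB.
  - by apply: cvg_at_right_filter; apply: cy; apply: ABT; rewrite /= in_itv/= lexx ltW.
  - by apply: cvg_at_left_filter; apply: cy; apply: ABT; rewrite /= in_itv/= lexx ltW.
have abT : `[a, b] `<=` `]0, T[.
  by apply: subset_trans ABT; apply: subset_itvScc; rewrite bnd_simp ltW.
have gab : mu.-integrable `[a, b] (EFin \o g).
  exact: locally_integrable_itv locg abT.
apply/ler_addgt0Pl => e e0.
have e20 : 0 < e / 2 by rewrite divr_gt0.
have [h h0 [hab [ha hb]]] : exists2 h : R, 0 < h & a + h <= b - h /\
    ((forall x, a <= x <= a + h -> `|dy x - dy a| <= e / 2) /\
    (forall x : R, b - h <= x <= b -> `|dy x - dy b| <= e / 2)).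
  have near_dy c : c \in `]0, T[ -> exists2 r : R, 0 < r &
      forall x : R, `|c - x| < r -> `|dy x - dy c| <= e / 2.
    move=> /cdy /cvgrPdist_le /(_ _ e20) /nbhs_ballP[r/= r0 rP].
    by exists r => // x cx; rewrite distrC; exact: rP.
  have [|ra ra0 raP] := near_dy a; first by rewrite in_itv/= a0 (lt_trans ab).
  have [|rb rb0 rbP] := near_dy b; first by rewrite in_itv/= bT (lt_trans a0).
  (* The first two bounds keep the transition zones of the steps where y' is within e / 2 of its
     value at [a] or [b]; the third keeps the zones from overlapping. *)
  pose h := Num.min (Num.min (ra / 2) (rb / 2)) ((b - a) / 2).
  have h0 : 0 < h by rewrite !lt_min !divr_gt0 ?subr_gt0.
  have hra : h <= ra / 2 by rewrite !ge_min lexx.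
  have hrb : h <= rb / 2 by rewrite !ge_min lexx orbT.
  have hba : h <= (b - a) / 2 by rewrite !ge_min lexx orbT.
  exists h => //; split; first by lra.
  split=> x /andP[x1 x2]; [apply: raP|apply: rbP].
    by rewrite distrC ger0_norm; lra.
  by rewrite ger0_norm; lra.
have [sa Hsa] : exists s, is_step s a (a + h) by apply: step_exists; lra.
have [sb Hsb] : exists s, is_step s (b - h) b by apply: step_exists; lra.
have ava : `|\int[mu]_(x in `[A, B]) (dy x * sa^`()%classic x) - dy a| <= e / 2.
  by apply: (step_average (c := a) (d := a + h)) => //; lra.
have avb : `|\int[mu]_(x in `[A, B]) (dy x * sb^`()%classic x) - dy b| <= e / 2.
  by apply: (step_average (c := b - h) (d := b)) => //; lra.
(* [phi'] is an approximate unit mass at [a] minus one at [b], so that testing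
   against [phi] approximately yields [dy b - dy a]. *)
pose phi x := sa x + -1 * sb x.
have Dphi n : ndifferentiable n phi.
  have [? _ _ _] := Hsa; have [? _ _ _] := Hsb.
  apply: ndifferentiableD => //; apply: ndifferentiableM => //.
  exact: ndifferentiable_cst.
have phi0 x : x \notin `[a, b] -> phi x = 0.
  have [_ _ sa0 sa1] := Hsa; have [_ _ sb0 sb1] := Hsb.
  rewrite in_itv/= negb_and -!ltNge => /orP[xa|bx].
    by rewrite /phi sa0 ?sb0 ?mulr0 ?addr0; lra.
  by rewrite /phi sa1 ?sb1; lra.
have phi1 x : `|phi x| <= 1.
  have := @step_bounds sa a (a + h) x; have := @step_bounds sb (b - h) b x.
  have -> : b - h <= b by lra.
  have -> : a <= a + h by lra.
  move=> /(_ isT Hsb) + /(_ isT Hsa).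
  by rewrite /phi ler_norml; lra.
have dphi x : phi^`()%classic x = sa^`()%classic x - sb^`()%classic x.
  have [sa1 _ _ _] := Hsa; have [sb1 _ _ _] := Hsb.
  have da := @ndifferentiable1P 0 sa (sa1 1%N) x.
  have db := @ndifferentiable1P 0 sb (sb1 1%N) x.
  have -> : phi = sa - sb by apply/funext => t; rewrite /phi mulN1r.
  by rewrite !derive1E deriveB.
have dphi0 x : x < a \/ b < x -> phi^`()%classic x = 0.
  move=> xab; rewrite dphi (step_derive1_eq0 Hsa) ?(step_derive1_eq0 Hsb) ?subr0//.
    by case: xab => ?; [left|right]; lra.
  by case: xab => ?; [left|right]; lra.
have d2phi0 x : x < a \/ b < x -> phi^`(2)%classic x = 0.
  rewrite derive1nS derive1n1 => -[xa|bx]; apply: (@derive1_eq_near _ 0); near=> t;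
    apply: dphi0.
    by left; near: t; exact: lt_nbhsl.
  by right; near: t; exact: lt_nbhsr.
have /yg : test_function T phi by apply: (@test_functionP T a b).
rewrite sqrrN expr1n mul1r.
have cphi : {within `[A, B], continuous phi^`(2)%classic}.
  apply: continuous_subspaceT; apply: (@ndifferentiable_continuous 0).
  rewrite derive1nS derive1n1.
  by do 2 apply: ndifferentiable_derive1.
have cphi1 : {within `[A, B], continuous phi^`()%classic}.
  apply: continuous_subspaceT; apply: (@ndifferentiable_continuous 0).
  by apply: ndifferentiable_derive1.
have notab (A' B' x : R) : A' <= a -> b <= B' -> ~ `[A', B']%classic x -> x < a \/ b < x.
  move=> A'a bB' /=; rewrite in_itv/= => /negP; rewrite negb_and -!ltNge.
  by move=> /orP[?|?]; [left|right]; lra.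
rewrite (@Rintegral_supp `[A, B] `]0, T[) => //; last first.
  by move=> x _ /notab xAB; rewrite d2phi0 ?mulr0//; apply: xAB; exact: ltW.
rewrite (@Rintegral_supp `[a, b] `]0, T[) => //; last first.
  by move=> x _ /negP xab; rewrite phi0 ?mulr0.
rewrite (@Rintegration_by_parts _ y phi^`()%classic dy) //; last first.
  apply: derivable_oo_LRcontinuousT; apply: (@ndifferentiable1P 0).
  exact: ndifferentiable_derive1.
rewrite !dphi0 ?mulr0 ?subrr ?sub0r; [|by left|by right].
have cmul s : (forall n, ndifferentiable n s) ->
    mu.-integrable `[A, B] (EFin \o (fun x => dy x * s^`()%classic x)).
  move=> Ds; apply: integrable_segment; apply: within_continuousM => //.
  apply: continuous_subspaceT; apply: (@ndifferentiable_continuous 0).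
  exact: ndifferentiable_derive1.
have -> : \int[mu]_(x in `[A, B]) (dy x * phi^`()%classic x) =
  \int[mu]_(x in `[A, B]) (dy x * sa^`()%classic x) -
  \int[mu]_(x in `[A, B]) (dy x * sb^`()%classic x).
  have [? _ _ _] := Hsa; have [? _ _ _] := Hsb.
  rewrite -RintegralB//; [|exact: cmul|exact: cmul].
  by apply: eq_Rintegral => x _; rewrite dphi mulrBr.
set Ia := Rintegral _ _ _ in ava *; set Ib := Rintegral _ _ _ in avb *.
move=> IE.
have gphi : `|\int[mu]_(x in `[a, b]) (g x * phi x)| <= \int[mu]_(x in `[a, b]) `|g x|.
  have gphii : mu.-integrable `[a, b] (EFin \o (fun x => g x * phi x)).
    apply: (@le_integrable _ _ _ mu `[a, b] _ _ (EFin \o g)) => //.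
      apply/measurable_EFinP; apply: measurable_funM.
        by apply/measurable_EFinP; case/integrableP: gab.
      apply: measurable_funTS; apply: continuous_measurable_fun.
      exact: (ndifferentiable_continuous (Dphi 1)).
    move=> x _ /=; rewrite lee_fin normrM.
    by rewrite ler_piMr.
  apply: (le_trans (le_normr_Rintegral _ gphii)) => //.
  apply: le_Rintegral => //; [exact: integrable_EFin_norm..|].
  by move=> x _; rewrite normrM ler_piMr.
rewrite -IE in gphi; move: gphi ava avb; rewrite !ler_norml.
by set J := Rintegral _ _ _; lra.
Unshelve. all: by end_near. Qed.

End WeakSecondDerivative.

(** * Integrals of powers and the functional equation of Gamma *)

Section ImproperFTC.
Context {R : realType}.
Local Notation mu := (@lebesgue_measure R).
Implicit Types (f F : R -> R).

Lemma nondecreasing_itvcc (u v : R^nat) : nonincreasing_seq u ->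
  nondecreasing_seq v -> nondecreasing_seq (fun n => `[u n, v n]%classic).
Proof.
move=> ndu ndv m n mn; rewrite subsetEset; apply: subset_itvScc;
  rewrite bnd_simp; [exact: ndu|exact: ndv].
Qed.

Lemma harmonic_nonincreasing : nonincreasing_seq (@harmonic R).
Proof. by move=> m n mn; rewrite lef_pV2 ?posrE ?ltr0n// ler_nat ltnS. Qed.

(** The integrand may blow up at the ends, as the power kernels do. The theorem on compact
    subintervals passes to the limit by monotone convergence on the left and by continuity of F up
    to the ends on the right. *)
Lemma ge0_improper_FTC2 f F (a b : R) : a < b ->
  (forall x, a < x < b -> 0 <= f x) ->
  {in `]a, b[, continuous f} -> derivable_oo_LRcontinuous F a b ->
  {in `]a, b[, F^`()%classic =1 f} ->
  (\int[mu]_(x in `]a, b[) (f x)%:E = (F b - F a)%:E)%E.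
Proof.
move=> ab f0 cf [dF Fa Fb] Ff.
(* A third of the length makes [u n < v n] hold from n = 0 on. *)
pose d := (b - a) / 3; have d0 : 0 < d by rewrite divr_gt0// subr_gt0.
pose u n := a + d * harmonic n; pose v n := b - d * harmonic n.
have h0 n : 0 < d * harmonic n by rewrite mulr_gt0// invr_gt0 ltr0n.
have h1 n : d * harmonic n <= d.
  by rewrite ler_piMr ?(ltW d0)// invf_le1 ?ltr0n// ler1n.
have uv n : u n < v n.
  by have := h0 n; have := h1 n; rewrite /u /v /d; lra.
have au n : a < u n by rewrite ltrDl.
have vb n : v n < b by rewrite gtrBl.
have cvh : d * harmonic n @[n --> \oo] --> 0.
  by have := cvgMl_tmp (a := d) (@cvg_harmonic R); rewrite mulr0; exact.
have cvu : u n @[n --> \oo] --> a.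
  by have := cvgD (cvg_cst a) cvh; rewrite addr0; exact.
have cvv : v n @[n --> \oo] --> b.
  by have := cvgB (cvg_cst b) cvh; rewrite subr0; exact.
have sub n : `[u n, v n] `<=` `]a, b[.
  move=> x /=; rewrite !in_itv/= => /andP[ux xv].
  by rewrite (lt_le_trans (au n))// (le_lt_trans xv).
have UD : \bigcup_n `[u n, v n]%classic = `]a, b[%classic.
  rewrite eqEsubset; split=> [x [n _]|x /=]; first exact: sub.
  rewrite in_itv/= => /andP[ax xb].
  have : \forall n \near \oo, u n <= x /\ x <= v n.
    near=> n; split; near: n.
      by apply: cvgr_le cvu _ _.
    by apply: cvgr_ge cvv _ _.
  by move=> [n _ /(_ n (leqnn n))[ux xv]]; exists n => //=; rewrite in_itv/= ux.
have mf n : measurable_fun `[u n, v n] (EFin \o f).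
  apply/measurable_EFinP; apply: measurable_funS (sub n) _ => //.
  by apply: open_continuous_measurable_fun => //; apply/in_continuous_mksetP.
have := @ge0_nondecreasing_set_cvg_integral _ (measurableTypeR R) R
  (fun n => `[u n, v n]%classic) (EFin \o f) mu.
rewrite UD => cvi.
have {}cvi : (\int[mu]_(x in `[u n, v n]) (f x)%:E)%E @[n --> \oo] -->
    (\int[mu]_(x in `]a, b[) (f x)%:E)%E.
  apply: cvi => //.
    apply: nondecreasing_itvcc => m n mn.
      by rewrite lerD2l ler_pM2l// harmonic_nonincreasing.
    by rewrite lerD2l lerN2 ler_pM2l// harmonic_nonincreasing.
  by move=> n x /sub/=; rewrite in_itv/= lee_fin; exact: f0.
apply: cvg_unique cvi _ => //.
have -> : (fun n => \int[mu]_(x in `[u n, v n]) (f x)%:E)%E =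
    EFin \o (fun n => F (v n) - F (u n)).
  apply/funext => n; rewrite /= (@continuous_FTC2 _ _ F)//.
  - by apply: continuous_in_subspaceT => x /set_mem/sub; exact: cf.
  - have cF x : x \in `]a, b[ -> {for x, continuous F}.
      by move=> /dF dFx; apply: differentiable_continuous; exact/derivable1_diffP.
    split.
    + by move=> x xuv; apply: dF; apply: (sub n); exact: subset_itv_oo_cc xuv.
    + apply: cvg_at_right_filter; apply: cF; apply: (sub n).
      by rewrite /= in_itv/= lexx ltW.
    + apply: cvg_at_left_filter; apply: cF; apply: (sub n).
      by rewrite /= in_itv/= lexx ltW.
  - by move=> x xuv; apply: Ff; apply: (sub n); exact: subset_itv_oo_cc xuv.
apply: cvg_EFin; first by near=> n.
apply: cvgB.
  by move/cvg_at_leftP : Fb; apply.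
by move/cvg_at_rightP : Fa; apply.
Unshelve. all: by end_near. Qed.

End ImproperFTC.

(** * Integrals of powers with an end point singularity *)

Section PowerIntegrals.
Context {R : realType}.
Local Notation mu := (@lebesgue_measure R).

Lemma derivable_oo_LRcontinuous_reflect (F : R -> R) (c a b : R) :
  derivable_oo_LRcontinuous F (c - b) (c - a) ->
  derivable_oo_LRcontinuous (fun s => F (c - s)) a b.
Proof.
move=> [dF Fa Fb]; split.
- move=> x; rewrite in_itv/= => /andP[ax xb].
  have dFx : derivable F (c - x) 1 by apply: dF; rewrite in_itv/= !ltrD2l !ltrN2 ax xb.
  have := @is_derive1_comp R F (fun s => c - s) x _ _ (derivableP dFx).
  by move=> /(_ _ (is_deriveB (is_derive_cst c x 1) (is_derive_id x 1)))[].
- apply/cvg_at_rightP => u [ua cvu].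
  move/cvg_at_leftP : Fb; apply; split; first by move=> n; rewrite ltrD2l ltrN2.
  exact: cvgB (cvg_cst c) cvu.
- apply/cvg_at_leftP => u [ub cvu].
  move/cvg_at_rightP : Fa; apply; split; first by move=> n; rewrite ltrD2l ltrN2.
  exact: cvgB (cvg_cst c) cvu.
Qed.

Lemma continuous_powR (r x : R) : 0 < x -> {for x, continuous (fun t => t `^ r)}.
Proof.
move=> x0; apply: differentiable_continuous; apply/derivable1_diffP.
by apply: derivable_powR; rewrite in_itv/= x0.
Qed.

Lemma powR_LRcontinuous (r a b : R) : 0 < r -> 0 <= a -> a < b ->
  derivable_oo_LRcontinuous (fun t : R => t `^ r) a b.
Proof.
move=> r0 a0 ab; split.
- move=> x; rewrite in_itv/= => /andP[ax _]; apply: derivable_powR.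
  by rewrite in_itv/= (le_lt_trans a0).
- have [->|aN0] := eqVneq a 0; first by rewrite powR0 ?gt_eqF//; exact: powR_cvg0.
  by apply: cvg_at_right_filter; apply: continuous_powR; rewrite lt_neqAle eq_sym aN0.
- by apply: cvg_at_left_filter; apply: continuous_powR; rewrite (le_lt_trans a0).
Qed.

Lemma is_derive_powR_primitive (m x : R) : m < 1 -> 0 < x ->
  is_derive x 1 (fun t => (1 - m)^-1 * t `^ (1 - m)) (x `^ (- m)).
Proof.
move=> m1 x0; have m10 : 1 - m != 0 by rewrite subr_eq0 gt_eqF.
apply: is_derive_eq (is_deriveZ _ (is_derive1_powR (1 - m) x0)) _.
by rewrite /GRing.scale/= mulrA mulVf// mul1r; congr (_ `^ _); ring.
Qed.

Lemma derivable_oo_LRcontinuousZ (k : R) (F : R -> R) (a b : R) :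
  derivable_oo_LRcontinuous F a b ->
  derivable_oo_LRcontinuous (fun s => k * F s) a b.
Proof.
move=> [dF Fa Fb]; split.
- by move=> x /dF; exact: derivableZ.
- exact: cvgMl_tmp.
- exact: cvgMl_tmp.
Qed.

Lemma integral_powRN (m a b : R) : 0 <= m < 1 -> 0 <= a -> a < b ->
  (\int[mu]_(x in `]a, b[) (x `^ (- m))%:E =
   ((1 - m)^-1 * b `^ (1 - m) - (1 - m)^-1 * a `^ (1 - m))%:E)%E.
Proof.
move=> /andP[m0 m1] a0 ab.
have gt0 x : x \in `]a, b[ -> 0 < x.
  by rewrite in_itv/= => /andP[ax _]; exact: le_lt_trans ax.
apply: (ge0_improper_FTC2 (F := fun t => (1 - m)^-1 * t `^ (1 - m))) => //.
- by move=> x _; exact: powR_ge0.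
- by move=> x /gt0; exact: continuous_powR.
- by apply: derivable_oo_LRcontinuousZ; apply: powR_LRcontinuous; rewrite // subr_gt0.
- move=> x /gt0 x0; rewrite derive1E.
  exact: (@derive_val _ _ _ _ _ _ _ (is_derive_powR_primitive m1 x0)).
Qed.

(** Serves twice: for the factor of the weight that is singular at T, and for the Caputo kernel,
    including the cell that ends at the singularity ([b = c]). *)
Lemma integral_powRN_reflect (m c a b : R) : 0 <= m < 1 -> a < b -> b <= c ->
  (\int[mu]_(x in `]a, b[) ((c - x) `^ (- m))%:E =
   ((1 - m)^-1 * (c - a) `^ (1 - m) - (1 - m)^-1 * (c - b) `^ (1 - m))%:E)%E.
Proof.
move=> /andP[m0 m1] ab bc.
have gt0 x : x \in `]a, b[ -> 0 < c - x.
  by rewrite in_itv/= => /andP[ax xb]; rewrite subr_gt0 (lt_le_trans xb).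
pose F t := - (1 - m)^-1 * (c - t) `^ (1 - m).
have dF x : x \in `]a, b[ -> is_derive x 1 F ((c - x) `^ (- m)).
  move=> /gt0 x0.
  have := @is_derive1_comp R _ (fun s => c - s) x _ _ (is_derive_powR_primitive m1 x0).
  move=> /(_ _ (is_deriveB (is_derive_cst c x 1) (is_derive_id x 1))) /is_deriveN.
  rewrite (_ : - (_ \o _) = F); last first.
    by apply/funext => t; rewrite /F mulNr.
  by rewrite sub0r mulrN1 opprK.
rewrite (@ge0_improper_FTC2 R (fun x => (c - x) `^ (- m)) F) => //.
- by congr (_%:E); rewrite /F; ring.
- by move=> x _; exact: powR_ge0.
- move=> x /gt0 x0; apply: differentiable_continuous; apply/derivable1_diffP.
  have := @is_derive1_comp R _ (fun s => c - s) x _ _ (is_derive1_powR (- m) x0).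
  by move=> /(_ _ (is_deriveB (is_derive_cst c x 1) (is_derive_id x 1)))[].
- apply: derivable_oo_LRcontinuousZ.
  apply: (@derivable_oo_LRcontinuous_reflect (fun t => t `^ (1 - m))).
  by apply: powR_LRcontinuous; rewrite ?subr_gt0 ?subr_ge0// ltrD2l ltrN2.
- by move=> x /dF h; rewrite derive1E; exact: (@derive_val _ _ _ _ _ _ _ h).
Qed.

End PowerIntegrals.

(** * The functional equation of Gamma *)

Section GammaFunction.
Context {R : realType}.
Local Notation mu := (@lebesgue_measure R).

(** For a natural number k >= |x| and t = n + 1, one term of the exponential series gives t^x
    exp(-t) <= t^k exp(-t) <= (k+1)! / t. *)
Lemma powR_expRN_cvg0 (x : R) :
  n.+1%:R `^ x * expR (- n.+1%:R) @[n --> \oo] --> (0 : R).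
Proof.
pose k := Num.bound `|x|.
apply: (@squeeze_cvgr _ _ _ _ (fun=> 0) (fun n => k.+1`!%:R * harmonic n)).
- near=> n; rewrite mulr_ge0 ?powR_ge0 ?expR_ge0//=.
  set t : R := n.+1%:R; have t1 : 1 <= t by rewrite ler1n.
  have t0 : 0 < t by rewrite ltr0n.
  have xk : t `^ x <= t ^+ k.
    rewrite -powR_mulrn ?(ltW t0)//; apply: ler_powR => //.
    by rewrite (le_trans (ler_norm x))// ltW// archi_boundP.
  rewrite expRN ler_pdivrMr ?expR_gt0//.
  have {}et : t ^+ k.+1 / k.+1`!%:R <= expR t by have := expR_ge1Dxn k (ltW t0); lra.
  rewrite ler_pdivrMr ?ltr0n ?fact_gt0// in et.
  rewrite (le_trans xk)// -mulrA mulrCA ler_pdivlMl// -exprS (le_trans et)//.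
  by rewrite mulrC.
- exact: cvg_cst.
- by have := cvgMl_tmp (a := k.+1`!%:R) (@cvg_harmonic R); rewrite mulr0; exact.
Unshelve. all: by end_near. Qed.

(** Integration by parts on compact intervals exhausting the half line; the boundary term t^x
    exp(-t) tends to 0 at both ends, at 0 because x > 0. *)
Lemma Gamma_rec (x : R) : 0 < x -> Gamma (x + 1) = x * Gamma x.
Proof.
move=> x0.
(* The factor 1/2 separates [u 0] from [v 0 = 1]. *)
pose u n : R := 2^-1 * harmonic n; pose v n : R := n.+1%:R.
have u0 n : 0 < u n by rewrite mulr_gt0// invr_gt0 ltr0n.
have uv n : u n < v n.
  rewrite (@lt_le_trans _ _ 1)// /u ?ler1n// mulrC.
  rewrite (@le_lt_trans _ _ (2^-1))//; last by lra.
  by rewrite ler_piMl// invf_le1 ?ltr0n// ler1n.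
have cvu : u n @[n --> \oo] --> 0.
  by have := cvgMl_tmp (a := 2^-1) (@cvg_harmonic R); rewrite mulr0; exact.
have sub n : `[u n, v n] `<=` `]0, +oo[.
  by move=> t /=; rewrite !in_itv/= andbT => /andP[ut _]; exact: lt_le_trans ut.
have UD : \bigcup_n `[u n, v n]%classic = `]0, +oo[%classic.
  rewrite eqEsubset; split=> [t [n _]|t /=]; first exact: sub.
  rewrite in_itv/= andbT => t0.
  have : \forall n \near \oo, u n <= t /\ t <= v n.
    near=> n; split; near: n.
      by apply: cvgr_le cvu _ _.
    exists (Num.bound t) => // n /= tn.
    rewrite /v (le_trans (ltW (archi_boundP (ltW t0))))// ler_nat.
    exact: leqW.
  by move=> [n _ /(_ n (leqnn n))[ut tv]]; exists n => //=; rewrite in_itv/= ut.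
have gt0 n t : t \in `[u n, v n] -> 0 < t.
  by rewrite in_itv/= => /andP[ut _]; exact: lt_le_trans ut.
have cE (t : R) : {for t, continuous (fun s : R => expR (- s))}.
  apply: (@continuous_comp _ _ _ -%R expR); first exact: opp_continuous.
  exact: continuous_expR.
have cg (r t : R) : 0 < t -> {for t, continuous (fun s : R => s `^ r * expR (- s))}.
  move=> t0; apply: continuousM; [exact: continuous_powR|exact: cE].
have mg (r : R) : measurable_fun `](0 : R), +oo[ (EFin \o (fun s : R => s `^ r * expR (- s))).
  apply/measurable_EFinP; apply: open_continuous_measurable_fun => //.
  by move=> t; rewrite inE/= in_itv/= andbT; exact: cg.
have cvi r : (\int[mu]_(t in `[u n, v n]) (t `^ r * expR (- t))%:E)%E @[n --> \oo] -->
    (\int[mu]_(t in `]0%R, +oo[) (t `^ r * expR (- t))%:E)%E.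
  rewrite -UD.
  apply: (@ge0_nondecreasing_set_cvg_integral _ (measurableTypeR R) R
    (fun n => `[u n, v n]%classic) (EFin \o (fun t => t `^ r * expR (- t))) mu) => //.
  - apply: nondecreasing_itvcc => m n mn.
      by rewrite ler_pM2l// harmonic_nonincreasing.
    by rewrite ler_nat.
  - by move=> n; apply: measurable_funS (sub n) (mg r).
  - by move=> n t _; rewrite lee_fin mulr_ge0 ?powR_ge0 ?expR_ge0.
have cf r n : {within `[u n, v n], continuous (fun s => s `^ r * expR (- s))}.
  by apply: continuous_in_subspaceT => t /set_mem/gt0; exact: cg.
pose F (t : R) := t `^ x * expR (- t).
pose f (t : R) := x * (t `^ (x - 1) * expR (- t)) - t `^ x * expR (- t).
have dF (t : R) : 0 < t -> is_derive t 1 F (f t).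
  move=> t0.
  have dN : is_derive t 1 (fun s : R => expR (- s)) (expR (- t) * -1).
    exact: (@is_derive1_comp R expR -%R t _ _ (is_derive_expR (- t))
      (is_deriveN (is_derive_id t 1))).
  apply: is_derive_eq (is_deriveM (is_derive1_powR x t0) dN) _.
  by rewrite /GRing.scale/= /f; ring.
have ir r n : mu.-integrable `[u n, v n] (EFin \o (fun t => t `^ r * expR (- t))).
  exact: integrable_segment.
have parts n : (x%:E * \int[mu]_(t in `[u n, v n]) (t `^ (x - 1) * expR (- t))%:E =
    (F (v n) - F (u n))%:E + \int[mu]_(t in `[u n, v n]) (t `^ x * expR (- t))%:E)%E.
  have cf' : {within `[u n, v n], continuous f}.
    move=> t; apply: cvgB; last exact: cf.
    by apply: cvgMl_tmp; exact: cf.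
  have FTC : (\int[mu]_(t in `[u n, v n]) (f t)%:E = (F (v n) - F (u n))%:E)%E.
    rewrite (@continuous_FTC2 _ _ F)//.
    - have cFt t : 0 < t -> {for t, continuous F} by exact: cg.
      split.
      + move=> t /subset_itv_oo_cc /gt0 /dF []//.
      + by apply: cvg_at_right_filter; apply: cFt; exact: u0.
      + by apply: cvg_at_left_filter; apply: cFt; exact: lt_trans (uv n).
    - move=> t /subset_itv_oo_cc /gt0 /dF h; rewrite derive1E.
      exact: (@derive_val _ _ _ _ _ _ _ h).
  rewrite -integralZl//; last exact: ir.
  rewrite -FTC -integralD//; last 2 first.
    exact: integrable_segment.
    exact: ir.
  by apply: eq_integral => t _; rewrite -EFinM -EFinD /f subrK.
have cF : (F (v n) - F (u n))%:E @[n --> \oo] --> 0%:E.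
  apply: cvg_EFin; first by near=> n.
  rewrite -[0]subr0; apply: cvgB; first exact: powR_expRN_cvg0.
  apply: (@squeeze_cvgr _ _ _ _ (fun=> 0) (fun n => u n `^ x)).
  - near=> n; rewrite mulr_ge0 ?powR_ge0 ?expR_ge0//=.
    by rewrite ler_piMr ?powR_ge0// expR_le1 oppr_le0 ltW.
  - exact: cvg_cst.
  - by have /cvg_at_rightP := powR_cvg0 x0; apply.
(* The limit is taken in the extended reals, so that convergence of the two
   integrals need not be known: if they diverge, [fine] makes both sides 0. *)
have lim : (x%:E * \int[mu]_(t in `]0%R, +oo[) (t `^ (x - 1) * expR (- t))%:E =
   \int[mu]_(t in `]0%R, +oo[) (t `^ x * expR (- t))%:E)%E.
  have l1 := cvgeZl (isT : x%:E \is a fin_num) (cvi (x - 1)).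
  have l2 := cvgeD (isT : 0%:E +? _)%E cF (cvi x); rewrite add0e in l2.
  rewrite (eq_fun parts) in l1.
  by apply: cvg_unique l1 _ => //; exact: l2.
rewrite /Gamma addrK /Rintegral -lim.
set I := (\int[mu]_(t in _) _)%E.
have : (0%:E <= I)%E.
  by apply: integral_ge0 => t _; rewrite lee_fin mulr_ge0 ?powR_ge0 ?expR_ge0.
case: I => [r _|_|//]; first by rewrite -EFinM.
by rewrite /= gt0_muley ?lte_fin//= mulr0.
Unshelve. all: by end_near. Qed.

End GammaFunction.

(** * Weighted bound on the modulus of continuity of the derivative *)

Section WeightedHoelder.
Context d (T : measurableType d) (R : realType).
Variables (mu : {measure set T -> \bar R}) (D : set T).

(** Hoelder's inequality for the factors |g| w^(1/p) and w^(-1/p) with q = p / (p - 1), so that q /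
    p = 1 / (p - 1). In the extended reals, finiteness of the two factors is left to the
    applications. *)
Lemma weighted_hoelder (p : R) (g w : T -> R) : measurable D -> 1 < p ->
  measurable_fun D g -> measurable_fun D w -> (forall x, D x -> 0 < w x) ->
  (\int[mu]_(x in D) `|g x|%:E <=
   (\int[mu]_(x in D) (`|g x| `^ p * w x)%:E) `^ p^-1 *
   (\int[mu]_(x in D) (w x `^ (- (p - 1)^-1))%:E) `^ (1 - p^-1))%E.
Proof.
move=> mD p1 mg mw w0.
have p0 : 0 < p by rewrite (lt_trans ltr01).
have p10 : 0 < p - 1 by rewrite subr_gt0.
pose q := p / (p - 1); have q0 : 0 < q by rewrite divr_gt0.
have qV : q^-1 = 1 - p^-1 by rewrite /q; field; rewrite !gt_eqF.
pose f := (fun x => `|g x| * w x `^ p^-1) \_ D.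
pose h := (fun x => w x `^ (- p^-1)) \_ D.
have mwr r : measurable_fun D (fun x => w x `^ r).
  exact: (measurableT_comp (measurable_powR r)).
have mf : measurable_fun setT f.
  apply/(measurable_restrictT _ mD); apply: measurable_funM => //.
  exact: measurableT_comp.
have mh : measurable_fun setT h by apply/(measurable_restrictT _ mD).
have pq : p^-1 + q^-1 = 1 by rewrite qV; ring.
have := hoelder mu mf mh p0 q0 pq.
rewrite Lnorm1 Lnorm.unlock qV.
rewrite (_ : \int[mu]_x _ = \int[mu]_(x in D) `|g x|%:E)%E; last first.
  rewrite [RHS]integral_mkcond; apply: eq_integral => x _.
  rewrite /f /h /= !patchE; case: ifPn => [/set_mem xD|_]; last by rewrite mul0r normr0.
  rewrite -mulrA -powRD; last by rewrite (gt_eqF (w0 _ xD)) implybT.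
  by rewrite subrr powRr0 mulr1 normr_id.
rewrite (_ : \int[mu]_x _ = \int[mu]_(x in D) (`|g x| `^ p * w x)%:E)%E; last first.
  rewrite [RHS]integral_mkcond; apply: eq_integral => x _.
  rewrite /f /= !patchE; case: ifPn => [/set_mem xD|_]; last by rewrite normr0 powR0 ?gt_eqF.
  rewrite normrM normr_id (ger0_norm (powR_ge0 _ _)) powRM ?powR_ge0//.
  by rewrite -powRrM mulVf ?gt_eqF// powRr1// ltW// w0.
rewrite (_ : \int[mu]_x _ = \int[mu]_(x in D) (w x `^ (- (p - 1)^-1))%:E)%E//.
rewrite [RHS]integral_mkcond; apply: eq_integral => x _.
rewrite /h /= !patchE; case: ifPn => [/set_mem xD|_]; last by rewrite normr0 powR0 ?gt_eqF.
rewrite (ger0_norm (powR_ge0 _ _)) -powRrM; congr (_ `^ _)%:E.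
by rewrite /q; field; rewrite !gt_eqF.
Qed.

End WeightedHoelder.

(** * Integrals of negative powers of the Jacobi weight *)

Section JacobiWeight.
Context {R : realType}.
Local Notation mu := (@lebesgue_measure R).

(** A ratio z / (x + y) in [0, 1] is at most its r-th power; adding the cases z = x and z = y gives
    the claim. In the form d^r - c^r <= (d - c)^r it says that, among intervals of given length, the
    one starting at the singularity carries the largest integral. *)
Lemma powR_subadditive (x y r : R) : 0 <= x -> 0 <= y -> 0 < r <= 1 ->
  (x + y) `^ r <= x `^ r + y `^ r.
Proof.
move=> x0 y0 /andP[r0 r1].
have [->|xN0] := eqVneq x 0; first by rewrite powR0 ?gt_eqF// !add0r.
have xp : 0 < x by rewrite lt_neqAle eq_sym xN0.
have s0 : 0 < x + y by rewrite ltr_wpDr.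
have H (z : R) : 0 <= z <= x + y -> z / (x + y) * (x + y) `^ r <= z `^ r.
  move=> /andP[z0 zs].
  have [->|zN0] := eqVneq z 0; first by rewrite !mul0r powR_ge0.
  have zp : 0 < z by rewrite lt_neqAle eq_sym zN0.
  have -> : z `^ r = (z / (x + y)) `^ r * (x + y) `^ r.
    by rewrite -powRM ?divr_ge0 ?(ltW s0)// divfK// gt_eqF.
  rewrite ler_wpM2r ?powR_ge0//; apply: ger1_powR => //.
  by rewrite divr_gt0//= ler_pdivrMr// mul1r.
have := H x; have := H y; rewrite x0 y0 lerDl lerDr x0 y0 => /(_ isT) Hy /(_ isT) Hx.
apply: le_trans (lerD Hx Hy); rewrite -mulrDl -mulrDl divff ?gt_eqF//.
by rewrite mul1r.
Qed.

Lemma measurable_jacobi_weight (T m g : R) (D : set R) :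
  measurable_fun D (jacobi_weight T m g).
Proof.
apply: measurable_funM; first exact: measurable_funTS (measurable_powR m).
apply: (measurableT_comp (measurable_powR g)).
by apply: measurable_funB; [exact: measurable_cst|exact: measurable_id].
Qed.

Lemma jacobi_weight_gt0 (T m g t : R) : 0 < t < T -> 0 < jacobi_weight T m g t.
Proof. by move=> /andP[t0 tT]; rewrite mulr_gt0// powR_gt0// subr_gt0. Qed.

Lemma jacobi_weightX (T m g r t : R) : 0 < t < T ->
  jacobi_weight T m g t `^ r = jacobi_weight T (m * r) (g * r) t.
Proof.
move=> /andP[t0 tT].
by rewrite /jacobi_weight powRM ?powR_ge0// -!powRrM.
Qed.

(** On either half of (0, T) one factor only can be singular and the other is at most its value at T
    / 2. Adding both bounds spares a case distinction for intervals across the midpoint. *)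
Lemma jacobi_weightN_le (T m g t : R) : 0 <= m -> 0 <= g -> 0 < t < T ->
  jacobi_weight T (- m) (- g) t <=
  (T / 2) `^ (- g) * t `^ (- m) + (T / 2) `^ (- m) * (T - t) `^ (- g).
Proof.
move=> m0 g0 /andP[t0 tT]; rewrite /jacobi_weight.
have T0 : 0 < T / 2 by rewrite divr_gt0// (lt_trans t0).
have anti r s x : 0 <= r -> 0 < s -> s <= x -> x `^ (- r) <= s `^ (- r).
  move=> r0 s0 sx; rewrite !powRN lef_pV2 ?posrE ?powR_gt0 ?(lt_le_trans s0)//.
  by apply: ge0_ler_powR; rewrite // nnegrE (le_trans (ltW s0)).
have [tT2|tT2] := leP t (T / 2).
  rewrite ler_wpDr ?mulr_ge0 ?powR_ge0// mulrC ler_wpM2r ?powR_ge0//.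
  by apply: anti => //; lra.
rewrite ler_wpDl ?mulr_ge0 ?powR_ge0// ler_wpM2r ?powR_ge0//.
by apply: anti => //; exact: ltW.
Qed.

Lemma integral_jacobi_weightN_le (T m g : R) : 0 < T -> 0 <= m < 1 -> 0 <= g < 1 ->
  exists2 K : R, 0 < K & forall a b tau : R, 0 <= a -> a < b -> b <= T ->
    b - a <= tau -> tau <= T ->
    (\int[mu]_(t in `]a, b[) (jacobi_weight T (- m) (- g) t)%:E <=
     (K * tau `^ (1 - Num.max m g))%:E)%E.
Proof.
move=> T0 m01 g01; set n := Num.max m g.
have /andP[m0 m1] := m01; have /andP[g0 g1] := g01.
have n1 : n < 1 by rewrite gt_max m1.
have mn : m <= n by rewrite le_max lexx.
have gn : g <= n by rewrite le_max lexx orbT.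
have T2 : 0 < T / 2 by rewrite divr_gt0.
(* The power of T / 2 bounds the factor that is not singular, 1 / (1 - m) comes from the primitive,
   and T^(n - m) pays for lowering the exponent of the length from 1 - m to 1 - n. *)
pose K1 := (T / 2) `^ (- g) * ((1 - m)^-1 * T `^ (n - m)).
pose K2 := (T / 2) `^ (- m) * ((1 - g)^-1 * T `^ (n - g)).
exists (K1 + K2).
  by rewrite addr_gt0// !mulr_gt0 ?powR_gt0// invr_gt0 subr_gt0.
move=> a b tau a0 ab bT batau tauT.
have ba0 : 0 < b - a by rewrite subr_gt0.
have tau0 : 0 < tau := lt_le_trans ba0 batau.
have pw (r : R) : 0 <= r -> r < 1 -> r <= n ->
    (1 - r)^-1 * (b - a) `^ (1 - r) <= (1 - r)^-1 * T `^ (n - r) * tau `^ (1 - n).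
  move=> r0 r1 rn; rewrite -mulrA ler_pM2l ?invr_gt0 ?subr_gt0//.
  have -> : 1 - r = (n - r) + (1 - n) by ring.
  rewrite powRD; last by rewrite (gt_eqF ba0) implybT.
  apply: ler_pM; rewrite ?powR_ge0//; apply: ge0_ler_powR;
    rewrite ?nnegrE ?subr_ge0 ?(ltW ba0) ?(ltW T0) ?(ltW tau0) ?(ltW n1)
      ?(ltW ab)//.
  exact: le_trans tauT.
(* Here [c] and [d] are the distances of the end points from the singularity: [a] and [b] for the
   one at 0, [T - b] and [T - a] for the one at T. *)
have sub r c d : 0 <= r < 1 -> 0 <= c -> c <= d -> d - c = b - a ->
    (1 - r)^-1 * d `^ (1 - r) - (1 - r)^-1 * c `^ (1 - r) <=
    (1 - r)^-1 * (b - a) `^ (1 - r).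
  move=> /andP[r0 r1] c0 cd dc; rewrite -mulrBr ler_pM2l ?invr_gt0 ?subr_gt0//.
  rewrite lerBlDr -dc -[in X in X `^ _ <= _](subrK c d).
  by apply: powR_subadditive; rewrite ?subr_ge0// subr_gt0 r1 gerBl.
apply: (@le_trans _ _ (\int[mu]_(t in `]a, b[)
  (((T / 2) `^ (- g))%:E * (t `^ (- m))%:E +
   ((T / 2) `^ (- m))%:E * ((T - t) `^ (- g))%:E))%E).
  apply: ge0_le_integral => //=.
  - by move=> t _; rewrite lee_fin mulr_ge0 ?powR_ge0.
  - by apply/measurable_EFinP; exact: measurable_jacobi_weight.
  - apply: emeasurable_funD.
      apply/measurable_EFinP; apply: measurable_funM => //.
      exact: measurable_funTS (measurable_powR _).
    apply/measurable_EFinP; apply: measurable_funM => //.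
    apply: (measurableT_comp (measurable_powR _)).
    exact: measurable_funB.
  - move=> t; rewrite in_itv/= => /andP[at' tb].
    rewrite -!EFinM -EFinD lee_fin jacobi_weightN_le//.
    by rewrite (le_lt_trans a0)//= (lt_le_trans tb).
have mp r : measurable_fun `]a, b[ (fun t => (t `^ r)%:E).
  by apply/measurable_EFinP; exact: measurable_funTS (measurable_powR _).
have mq r : measurable_fun `]a, b[ (fun t => ((T - t) `^ r)%:E).
  apply/measurable_EFinP; apply: (measurableT_comp (measurable_powR _)).
  exact: measurable_funB.
rewrite ge0_integralD//; last 4 first.
- by move=> t _; rewrite -EFinM lee_fin mulr_ge0 ?powR_ge0.
- apply/measurable_EFinP; apply: measurable_funM => //.
  by apply/measurable_EFinP; exact: mp.
- by move=> t _; rewrite -EFinM lee_fin mulr_ge0 ?powR_ge0.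
- apply/measurable_EFinP; apply: measurable_funM => //.
  by apply/measurable_EFinP; exact: mq.
have Z (k : R) (f : R -> R) : 0 <= k -> (forall t, 0 <= f t) ->
    measurable_fun `]a, b[ (fun t => (f t)%:E) ->
    (\int[mu]_(t in `]a, b[) (k%:E * (f t)%:E) =
     k%:E * \int[mu]_(t in `]a, b[) (f t)%:E)%E.
  by move=> k0 f0 mf; apply: ge0_integralZl_EFin => // t _; rewrite lee_fin.
rewrite (Z _ (fun t => t `^ (- m)))//; last 2 first.
- exact: powR_ge0.
- by move=> t; exact: powR_ge0.
rewrite (Z _ (fun t => (T - t) `^ (- g)))//; last 2 first.
- exact: powR_ge0.
- by move=> t; exact: powR_ge0.
rewrite integral_powRN// integral_powRN_reflect// -!EFinM -EFinD lee_fin.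
rewrite [leRHS]mulrDl; apply: lerD; rewrite -[leRHS]mulrA ler_pM2l ?powR_gt0//.
  by apply: le_trans (pw _ m0 m1 mn); apply: sub => //; exact: ltW.
apply: le_trans (pw _ g0 g1 gn); apply: sub => //; lra.
Qed.

End JacobiWeight.

(** * The modulus of continuity of y' in terms of the Sobolev norm *)

Section DerivativeModulus.
Context {R : realType}.
Local Notation mu := (@lebesgue_measure R).

(** The norm is built on a real-valued integral, which defaults to 0 when the integral is infinite.
    Membership in the Sobolev space makes all three summands integrable and so excludes this
    default. *)
Lemma Sobolev2_norm_ge (T p : R) (w y : R -> R) :
  measurable_fun `]0, T[ w -> (forall t, 0 < t < T -> 0 <= w t) ->
  in_weighted_Sobolev T w 2 p y ->
  (\int[mu]_(t in `]0%R, T[) (`|weak_derivative T 2 y t| `^ p * w t)%:E <=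
   (\int[mu]_(t in `]0%R, T[)
     ((\sum_(0 <= k < 3) `|weak_derivative T k y t| `^ p) * w t))%R%:E)%E.
Proof.
move=> mw w0 [y0 yk]; pose D k := weak_derivative T k y.
have Dk k : (k < 3)%N -> in_weighted_Lp T w p (D k).
  by case: k => // k k3; have [] := yk k.+1.
have iD k : (k < 3)%N ->
    mu.-integrable `]0, T[ (EFin \o (fun t => `|D k t| `^ p * w t)).
  move=> /Dk[mDk finDk].
  have mDw : measurable_fun `]0, T[ (fun t => `|D k t| `^ p * w t).
    apply: measurable_funM => //; apply: (measurableT_comp (measurable_powR p)).
    exact: measurableT_comp.
  apply/integrableP; split; first exact/measurable_EFinP.
  apply: le_lt_trans finDk; rewrite le_eqVlt; apply/orP; left; apply/eqP.
  apply: eq_integral => t; rewrite inE/= in_itv/= => t0T.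
  by rewrite ger0_norm// mulr_ge0 ?powR_ge0 ?w0.
rewrite -(fineK (integrable_fin_num _ (iD 2%N isT)))// lee_fin.
apply: le_Rintegral => //; first exact: iD.
  have := @integrable_sum _ _ _ mu _ (measurable_itv `]0, T[) _ (index_iota 0 3)
    (fun k => (0 <= k < 3)%N) (fun k t => (`|D k t| `^ p * w t)%:E) iD.
  by apply: eq_integrable => // t _ /=; rewrite -big_nat sumEFin mulr_suml.
move=> t; rewrite /= in_itv/= => t0T; rewrite ler_wpM2r ?w0//.
by rewrite big_nat_recr//= lerDr sumr_ge0// => k _; exact: powR_ge0.
Qed.

(** The hypotheses m, g < p - 1 put the exponents m / (p - 1) and g / (p - 1) of the dual weight
    below 1, and (1 - nu / (p - 1)) (1 - 1 / p) = 1 - (1 + nu) / p yields the rate. The points stay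
    inside (0, T), since the two-sided derivative at 0 or T would depend on values of y outside the
    interval. *)
Lemma derive1_modulus (p T m g : R) : 1 < p -> 0 < T ->
  0 <= m < p - 1 -> 0 <= g < p - 1 ->
  let w := jacobi_weight T m g in
  exists2 K : R, 0 < K & forall y,
    in_weighted_Sobolev T w 2 p y -> C1_on_itv 0 T y ->
    forall a b tau : R, 0 < a < T -> 0 < b < T -> `|b - a| <= tau -> tau <= T ->
    `|y^`()%classic b - y^`()%classic a| <=
      K * tau `^ (1 - (1 + Num.max m g) / p) * weighted_Sobolev_norm T w 2 p y.
Proof.
move=> p1 T0 /andP[m0 m1] /andP[g0 g1] w; set nu := Num.max m g.
have p0 : 0 < p by rewrite (lt_trans ltr01).
have p10 : 0 < p - 1 by rewrite subr_gt0.
have p1V0 : 0 < (p - 1)^-1 by rewrite invr_gt0.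
have mw D : measurable_fun D w by exact: measurable_jacobi_weight.
have w0 t : 0 < t < T -> 0 < w t by exact: jacobi_weight_gt0.
have m01 : 0 <= m * (p - 1)^-1 < 1.
  by rewrite mulr_ge0 ?(ltW p1V0)//= ltr_pdivrMr// mul1r.
have g01 : 0 <= g * (p - 1)^-1 < 1.
  by rewrite mulr_ge0 ?(ltW p1V0)//= ltr_pdivrMr// mul1r.
have [K0 K00 HK] := integral_jacobi_weightN_le T0 m01 g01.
rewrite -maxr_pMl ?(ltW p1V0)// -/nu in HK.
exists (K0 `^ (1 - p^-1)); first by rewrite powR_gt0.
move=> y Sy C1y a b tau.
wlog : a b / a < b.
  move=> H a0T b0T abt tT; have [ab|ba|->] := ltgtP a b.
  - exact: H.
  - by rewrite distrC; apply: H => //; rewrite distrC.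
  - by rewrite subrr normr0 !mulr_ge0 ?powR_ge0.
move=> ab /andP[a0 aT] /andP[b0 bT]; rewrite gtr0_norm ?subr_gt0// => abt tT.
pose D := weak_derivative T 2 y.
(* The existence clause of the Sobolev hypothesis rules out the default value of [xget]. *)
have wD : is_weak_derivative T 2 y D.
  have [_ /(_ 2%N isT)[[g' wg'] _]] := Sy.
  by rewrite /D /weak_derivative; case: xgetP => // /(_ g').
have mD : measurable_fun `]0, T[ D by have [_ []] := wD.
have sub : `]a, b[ `<=` `]0, T[.
  by apply: subset_itvW => //; exact: ltW.
have iD : mu.-integrable `[a, b] (EFin \o (fun x => `|D x|)).
  apply: integrable_EFin_norm => //; have [_ locD _] := wD.
  apply: (locally_integrable_itv locD) => x /=; rewrite !in_itv/= => /andP[ax xb].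
  by rewrite (lt_le_trans a0)// (le_lt_trans xb).
apply: (le_trans (dist_derive1_le C1y wD a0 ab bT)).
rewrite -Rintegral_itv_bndo_bndc; last first.
  by apply: integrableS iD => //; exact: subset_itv_co_cc.
rewrite -Rintegral_itv_obnd_cbnd; last first.
  by apply: integrableS iD => //; exact: subset_itv_oo_cc.
have tau0 : 0 < tau by rewrite (lt_le_trans _ abt)// subr_gt0.
rewrite -lee_fin fineK; last first.
  apply: integrable_fin_num => //.
  by apply: integrableS iD => //; exact: subset_itv_oo_cc.
have mDab := measurable_funS (measurable_itv `]0, T[) sub mD.
have wab t : `]a, b[%classic t -> 0 < w t.
  by move=> /sub; rewrite /= in_itv/=; exact: w0.
apply: le_trans.
  exact: (@weighted_hoelder _ _ _ mu _ _ _ _ (measurable_itv `]a, b[) p1 mDab (mw _) wab).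
pose N := \int[mu]_(t in `]0, T[)
     ((\sum_(0 <= k < 3) `|weak_derivative T k y t| `^ p) * w t).
have LN : (\int[mu]_(x in `]a, b[) (`|D x| `^ p * w x)%:E <= N%:E)%E.
  apply: le_trans (Sobolev2_norm_ge (mw _) _ Sy); last first.
    by move=> t /w0/ltW.
  apply: ge0_subset_integral => //.
  - apply/measurable_EFinP; apply: measurable_funM; last exact: mw.
    apply: (measurableT_comp (measurable_powR p)).
    exact: measurableT_comp.
  - move=> t; rewrite /= in_itv/= => /w0/ltW wt.
    by rewrite lee_fin mulr_ge0 ?powR_ge0.
have LK : (\int[mu]_(x in `]a, b[) (w x `^ (- (p - 1)^-1))%:E <=
    (K0 * tau `^ (1 - nu * (p - 1)^-1))%:E)%E.
  apply: le_trans (HK a b tau (ltW a0) ab (ltW bT) abt tT).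
  rewrite le_eqVlt; apply/orP; left; apply/eqP; apply: eq_integral => t.
  rewrite inE => /sub; rewrite /= in_itv/= => t0T.
  by rewrite jacobi_weightX// !mulrN.
have pV1 : p^-1 < 1 by rewrite invf_lt1.
have pe : (1 - nu * (p - 1)^-1) * (1 - p^-1) = 1 - (1 + nu) / p.
  by field; rewrite !gt_eqF.
have N0 : 0 <= N.
  apply: Rintegral_ge0 => t; rewrite /= in_itv/= => /w0/ltW wt.
  by rewrite mulr_ge0// sumr_ge0// => k _; exact: powR_ge0.
have K00' : 0 <= K0 * tau `^ (1 - nu * (p - 1)^-1).
  by rewrite mulr_ge0 ?powR_ge0// ltW.
have Ige0 (f : R -> R) : (forall t, `]a, b[%classic t -> 0 <= f t) ->
    (0 <= \int[mu]_(x in `]a, b[) (f x)%:E)%E.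
  by move=> f0; apply: integral_ge0 => t /f0; rewrite lee_fin.
apply: (@le_trans _ _ (N%:E `^ p^-1 *
    (K0 * tau `^ (1 - nu * (p - 1)^-1))%:E `^ (1 - p^-1))%E).
  apply: lee_pmul; rewrite ?poweR_ge0//; apply: gt0_ler_poweR => //.
  - by rewrite invr_ge0 ltW.
  - rewrite in_itv/= leey andbT; apply: Ige0 => t /wab/ltW wt.
    by rewrite mulr_ge0 ?powR_ge0.
  - by rewrite in_itv/= leey andbT lee_fin.
  - by rewrite subr_ge0 ltW.
  - by rewrite in_itv/= leey andbT; apply: Ige0 => t _; exact: powR_ge0.
  - by rewrite in_itv/= leey andbT lee_fin.
rewrite !poweR_EFin -EFinM lee_fin powRM ?powR_ge0 ?(ltW K00)//.
rewrite -powRrM pe mulrC /weighted_Sobolev_norm.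
exact: lexx.
Qed.

End DerivativeModulus.

(** * Consistency of the L1 scheme *)

Section CellEstimates.
Context {R : realType}.
Local Notation mu := (@lebesgue_measure R).
Implicit Types (u k y z : R -> R).

Lemma measurable_kernel (r t : R) (D : set R) :
  measurable_fun D (fun s => (t - s) `^ r).
Proof.
apply: (measurableT_comp (measurable_powR r)).
exact: measurable_funB.
Qed.

Lemma integrable_kernel (r t a c : R) : 0 <= r < 1 -> a < c -> c <= t ->
  mu.-integrable `]a, c[ (EFin \o (fun s => (t - s) `^ (- r))).
Proof.
move=> r01 ac ct; apply/integrableP; split.
  by apply/measurable_EFinP; exact: measurable_kernel.
rewrite (_ : \int[mu]_(x in _) _ = \int[mu]_(s in `]a, c[) ((t - s) `^ (- r))%:E)%E.
  by rewrite integral_powRN_reflect// ltry.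
by apply: eq_integral => s _; rewrite /= ger0_norm ?powR_ge0.
Qed.

Lemma Rintegral_kernel (r t a c : R) : 0 <= r < 1 -> a < c -> c <= t ->
  \int[mu]_(s in `]a, c[) (t - s) `^ (- r) =
  (1 - r)^-1 * ((t - a) `^ (1 - r) - (t - c) `^ (1 - r)).
Proof.
by move=> r01 ac ct; rewrite /Rintegral integral_powRN_reflect//= mulrBr.
Qed.

(** The case [c = t], where the kernel is unbounded but integrable, is the cell adjacent to t_n. *)
Lemma kernel_cell_le u (E r t a c : R) : 0 <= r < 1 -> a < c -> c <= t ->
  measurable_fun `]a, c[ u -> (forall s, a < s < c -> `|u s| <= E) ->
  `|\int[mu]_(s in `]a, c[) (u s * (t - s) `^ (- r))| <=
  E * ((1 - r)^-1 * ((t - a) `^ (1 - r) - (t - c) `^ (1 - r))).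
Proof.
move=> r01 ac ct mf uE; rewrite -Rintegral_kernel//.
have uE' s : `]a, c[%classic s -> `|u s| <= E by rewrite /= in_itv/=; exact: uE.
have := @le_normr_RintegralM _ _ _ mu _ (measurable_itv `]a, c[) u _ E mf uE'
  (integrable_kernel r01 ac ct).
move=> /le_trans; apply; rewrite le_eqVlt; apply/orP; left; apply/eqP.
by congr (_ * _); apply: eq_Rintegral => s _; rewrite ger0_norm ?powR_ge0.
Qed.

Lemma integrable_bounded_itv u (E a c : R) :
  measurable_fun `]a, c[ u -> (forall s, a < s < c -> `|u s| <= E) ->
  mu.-integrable `]a, c[ (EFin \o u).
Proof.
move=> mf uE.
have i1 : mu.-integrable `]a, c[ (EFin \o (fun=> 1 : R)).
  apply: (@integrableS _ _ _ mu `[a, c]) => //; first exact: subset_itv_oo_cc.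
  by apply: integrable_segment; apply: continuous_subspaceT => x; exact: cst_continuous.
have := @bounded_integrableM _ _ _ mu _ (measurable_itv `]a, c[) u (fun=> 1) E mf _ i1.
have -> : (fun x => u x * 1) = u by apply/funext => x; rewrite mulr1.
by apply => s; rewrite /= in_itv/=; exact: uE.
Qed.

(* The zero mean of [u] allows the kernel to be replaced by its oscillation. *)
Lemma kernel_cell_le_mean0 u (E r t a c : R) : 0 <= r < 1 -> a < c -> c < t ->
  measurable_fun `]a, c[ u -> (forall s, a < s < c -> `|u s| <= E) ->
  \int[mu]_(s in `]a, c[) u s = 0 ->
  `|\int[mu]_(s in `]a, c[) (u s * (t - s) `^ (- r))| <=
  E * (c - a) * ((t - c) `^ (- r) - (t - a) `^ (- r)).
Proof.
move=> /andP[r0 r1] ac ct mf uE u0; pose k s := (t - s) `^ (- r).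
have kmono s s' : s <= s' -> s' < t -> k s <= k s'.
  move=> ss' s't; have ts' : 0 < t - s' by lra.
  have ts : 0 < t - s by lra.
  rewrite /k !powRN lef_pV2 ?posrE; [|exact: powR_gt0|exact: powR_gt0].
  by apply: ge0_ler_powR; rewrite // ?nnegrE; lra.
have iu := integrable_bounded_itv mf uE.
have ik := integrable_kernel (introT andP (conj r0 r1)) ac (ltW ct).
have uE' s : `]a, c[%classic s -> `|u s| <= E by rewrite /= in_itv/=; exact: uE.
have iuk : mu.-integrable `]a, c[ (EFin \o (fun s => u s * k s)).
  exact: (@bounded_integrableM _ _ _ mu _ (measurable_itv `]a, c[) u k E mf uE' ik).
have icst (M : R) : mu.-integrable `]a, c[ (EFin \o (fun=> M)).
  by apply: (@integrable_bounded_itv _ `|M|).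
have iuc : mu.-integrable `]a, c[ (EFin \o (fun s => u s * k a)).
  exact: (@bounded_integrableM _ _ _ mu _ (measurable_itv `]a, c[) u _ E mf uE' (icst _)).
have -> : \int[mu]_(s in `]a, c[) (u s * k s) =
    \int[mu]_(s in `]a, c[) (u s * (k s - k a)).
  under [RHS]eq_Rintegral do rewrite mulrBr.
  by rewrite RintegralB// RintegralZr// u0 mul0r subr0.
have i2 : mu.-integrable `]a, c[ (EFin \o (fun s => u s * (k s - k a))).
  have := @integrable_EFinB _ _ _ mu _ (measurable_itv `]a, c[) _ _ iuk iuc.
  by apply: eq_integrable => // s _ /=; rewrite mulrBr.
apply: le_trans (le_normr_Rintegral _ i2) _ => //.
apply: (@le_trans _ _ (\int[mu]_(s in `]a, c[) (E * (k c - k a)))); last first.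
  rewrite Rintegral_cst//= lebesgue_measure_itv/= lte_fin ac -EFinD/=.
  by rewrite mulrAC.
apply: le_Rintegral => //; first exact: integrable_EFin_norm.
move=> s sac; rewrite normrM; have := sac; rewrite /= in_itv/= => /andP[as_ sc].
apply: ler_pM => //; first exact: uE'.
rewrite ger0_norm ?subr_ge0 ?lerB//.
  by apply: kmono => //; exact: ltW.
by apply: kmono; [exact: ltW|exact: lt_trans ct].
Qed.

(** By the mean value theorem the slope over the cell is itself a value of y' inside it. *)
Lemma derive1_mean_dist y (E a c : R) : a < c -> derivable_oo_LRcontinuous y a c ->
  (forall s s', a < s < c -> a < s' < c ->
    `|y^`()%classic s - y^`()%classic s'| <= E) ->
  forall s, a < s < c -> `|y^`()%classic s - (y c - y a) / (c - a)| <= E.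
Proof.
move=> ac yac yE s sac.
have [|s' s'ac ->] := @MVT R y y^`()%classic a c ac _ (derivable_oo_LRcontinuous_within yac).
  by move=> x xac; rewrite derive1E; apply: derivableP; have [+ _ _] := yac; exact.
by rewrite mulfK ?subr_eq0 ?gt_eqF//; apply: yE => //; rewrite in_itv/= in s'ac.
Qed.

End CellEstimates.

(** * The consistency error, cell by cell *)

Section L1Consistency.
Context {R : realType}.
Local Notation mu := (@lebesgue_measure R).

Lemma Rintegral_grid (f : R -> R) (tau : R) n : 0 < tau ->
  mu.-integrable `]0, n%:R * tau[ (EFin \o f) ->
  \int[mu]_(s in `]0, n%:R * tau[) f s =
  \sum_(0 <= j < n) \int[mu]_(s in `]j%:R * tau, j.+1%:R * tau[) f s.
Proof.
move=> t0; elim: n => [|n IH] fi.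
  by rewrite big_geq// mul0r set_itvoo0 Rintegral_set0.
have nn : n%:R * tau <= n.+1%:R * tau by rewrite ler_pM2r// ler_nat.
have n0 : 0 <= n%:R * tau by rewrite mulr_ge0// ltW.
have sub : `]0, n%:R * tau[ `<=` `]0, n.+1%:R * tau[ by apply: subset_itvl; rewrite bnd_simp.
have fin : mu.-integrable `]0, n%:R * tau[ (EFin \o f) by apply: integrableS fi.
have nn' : n%:R * tau < n.+1%:R * tau by rewrite ltr_pM2r// ltr_nat.
rewrite big_nat_recr//= -IH//.
have := @Rintegral_itvB _ f (BRight 0) (BLeft (n.+1%:R * tau)) (n%:R * tau) fi.
rewrite !bnd_simp -Rintegral_itv_bndo_bndc// => /(_ n0 nn') <-.
by rewrite addrC subrK.
Qed.

(** The left side is the form in which the scheme arises: replacing y' by its cell means gives each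
    increment of y the integral of the kernel over its cell, which is a multiple of b_(n-j-1). *)
Lemma L1_summation_by_parts (b Y : nat -> R) n : b 0%N = 1 -> (1 <= n)%N ->
  \sum_(0 <= j < n) b (n - j - 1)%N * (Y j.+1 - Y j) =
  Y n - b n.-1 * Y 0%N - \sum_(1 <= i < n) (b (n - i - 1)%N - b (n - i)%N) * Y i.
Proof.
case: n => // n b0 _ /=.
under eq_bigr do rewrite mulrBr.
rewrite sumrB big_nat_recr//= subSnn subnn b0 mul1r.
rewrite [X in _ - X]big_ltn//= subn0 subn1/= !big_add1/=.
under [in RHS]eq_bigr do rewrite mulrBl.
rewrite sumrB.
have -> : \sum_(0 <= i < n) b (n.+1 - i - 1)%N * Y i.+1 =
    \sum_(0 <= i < n) b (n.+1 - i.+1)%N * Y i.+1.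
  by apply: eq_bigr => i _; rewrite subSS subn1 subSKn.
by ring.
Qed.

Lemma C1_derive1_bounded (T : R) (y : R -> R) : 0 < T -> C1_on_itv 0 T y ->
  exists M : R, forall s, 0 < s < T -> `|y^`()%classic s| <= M.
Proof.
move=> T0 [_ [z cz yz]].
have [c _ cmax] := EVT_max (ltW T0) cz.
have [d _ dmin] := EVT_min (ltW T0) cz.
exists (`|z c| + `|z d|) => s s0T; rewrite yz ?in_itv//=.
have sT : s \in `[0, T] by move: s0T; rewrite in_itv/= => /andP[/ltW-> /ltW->].
rewrite ler_norml; have := cmax s sT; have := dmin s sT.
have := ler_norm (z c); have := ler_norm (- z d); rewrite normrN.
have := normr_ge0 (z c); have := normr_ge0 (z d); lra.
Qed.

Lemma C1_Rintegral_derive1 (T a b : R) (y : R -> R) : C1_on_itv 0 T y ->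
  0 <= a -> a < b -> b <= T ->
  \int[mu]_(s in `]a, b[) y^`()%classic s = y b - y a.
Proof.
move=> [y0T [z cz yz]] a0 ab bT.
have sub : `[a, b] `<=` `[0, T] by apply: subset_itvScc; rewrite bnd_simp.
have cz' : {within `[a, b], continuous z} by exact: continuous_subspaceW cz.
have iz := integrable_segment cz'.
have yz' : {in `]a, b[, y^`()%classic =1 z}.
  move=> s; rewrite in_itv/= => /andP[as_ sb]; apply: yz.
  by rewrite in_itv/= (le_lt_trans a0)//= (lt_le_trans sb).
have -> : \int[mu]_(s in `]a, b[) y^`()%classic s = \int[mu]_(s in `]a, b[) z s.
  by apply: eq_Rintegral => s /set_mem; exact: yz'.
rewrite Rintegral_itv_bndo_bndc; last first.
  by apply: integrableS iz => //; exact: subset_itv_oo_cc.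
rewrite Rintegral_itv_obnd_cbnd; last first.
  by apply: integrableS iz => //; exact: subset_itv_oc_cc.
rewrite /Rintegral (@continuous_FTC2 _ _ y)//.
exact: derivable_oo_continuousW y0T.
Qed.

Lemma L1_consistency (alpha T tau E : R) (y : R -> R) n : 0 < alpha < 1 ->
  0 < tau -> (1 <= n)%N -> n%:R * tau <= T -> 0 <= E -> C1_on_itv 0 T y ->
  (forall (j : nat) s s', (j < n)%N -> j%:R * tau < s < j.+1%:R * tau ->
    j%:R * tau < s' < j.+1%:R * tau ->
    `|y^`()%classic s - y^`()%classic s'| <= E) ->
  `|\int[mu]_(s in `]0, n%:R * tau[) (y^`()%classic s / (n%:R * tau - s) `^ alpha)
   - (1 - alpha)^-1 * tau `^ (- alpha) *
     (y (n%:R * tau) - L1_coef alpha n.-1 * y 0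
      - \sum_(1 <= i < n) (L1_coef alpha (n - i - 1)%N - L1_coef alpha (n - i)%N)
          * y (i%:R * tau))| <= E * tau `^ (1 - alpha) * (1 + (1 - alpha)^-1).
Proof.
move=> /andP[alpha0 alpha1] tau0 n1 nT E0 C1y yE.
have al01 : 0 <= alpha < 1 by rewrite ltW.
pose a (j : nat) : R := j%:R * tau; set t := n%:R * tau.
pose k s := (t - s) `^ (- alpha).
pose dy : R -> R := y^`()%classic.
pose A := (1 - alpha)^-1.
have t0 : 0 < t by rewrite mulr_gt0// ltr0n.
have T0 : 0 < T := lt_le_trans t0 nT.
have aS j : a j.+1 = a j + tau by rewrite /a -natr1 mulrDl mul1r.
have a0 j : 0 <= a j by rewrite mulr_ge0// ltW.
have at_ j : (j <= n)%N -> a j <= t by move=> jn; rewrite ler_pM2r// ler_nat.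
have aa j : a j < a j.+1 by rewrite aS ltrDl.
have dA j : a j.+1 - a j = tau by rewrite aS addrC addKr.
have taualpha : tau `^ (1 - alpha) = tau * tau `^ (- alpha).
  by rewrite powRD ?powRr1 ?(ltW tau0)// (gt_eqF tau0) implybT.
have cell j : (j < n)%N -> `]a j, a j.+1[ `<=` `]0, T[.
  move=> jn; apply: subset_itvW; first exact: a0.
  exact: le_trans (at_ _ jn) nT.
have sub0t : `]0, t[ `<=` `]0, T[ by apply: subset_itvW.
have mdy : measurable_fun `]0, T[ dy.
  apply: open_continuous_measurable_fun => //; apply/in_continuous_mksetP.
  exact: C1_derive1_continuous C1y.
(* A bounded y' is integrable against the kernel, which justifies splitting the real-valued integral
   over the cells. *)
have [M dyM] := C1_derive1_bounded T0 C1y.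
have fi : mu.-integrable `]0, t[ (EFin \o (fun s => dy s * k s)).
  apply: (@bounded_integrableM _ _ _ mu _ (measurable_itv `]0, t[) dy k M).
  - exact: measurable_funS sub0t mdy.
  - by move=> s /sub0t; rewrite /= in_itv/=; exact: dyM.
  - exact: integrable_kernel.
have -> : \int[mu]_(s in `]0, t[) (y^`()%classic s / (t - s) `^ alpha) =
    \int[mu]_(s in `]0, t[) (dy s * k s).
  by apply: eq_Rintegral => s _; rewrite /k powRN.
rewrite (Rintegral_grid tau0 fi).
pose m j := (y (a j.+1) - y (a j)) / tau.
pose e j := \int[mu]_(s in `]a j, a j.+1[) ((dy s - m j) * k s).
have yLR j : (j < n)%N -> derivable_oo_LRcontinuous y (a j) (a j.+1).
  move=> jn; have [y0T _] := C1y.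
  apply: derivable_oo_continuousW y0T => //.
  apply: subset_itvScc; rewrite bnd_simp; first exact: a0.
  exact: le_trans (at_ _ jn) nT.
have mdm j : (j < n)%N -> measurable_fun `]a j, a j.+1[ (fun s => dy s - m j).
  move=> jn; apply: measurable_funB => //.
  exact: measurable_funS (cell j jn) mdy.
have uE j s : (j < n)%N -> a j < s < a j.+1 -> `|dy s - m j| <= E.
  move=> jn sj; have := @derive1_mean_dist R y E _ _ (aa j) (yLR j jn) _ s sj.
  by rewrite dA; apply=> s1 s2; exact: yE.
(* The ends of cell j lie at distances (n - j) tau and (n - j - 1) tau from t, so the kernel
   integrates to [A * tau ^ (1 - alpha)] times b_(n-j-1); the division by tau in [m j] lowers the
   exponent to - alpha. The rest, [e j], is the error of the cell. *)
have cellE j : (j < n)%N -> \int[mu]_(s in `]a j, a j.+1[) (dy s * k s) =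
    A * tau `^ (- alpha) * (L1_coef alpha (n - j - 1)%N * (y (a j.+1) - y (a j))) + e j.
  move=> jn.
  have ik : mu.-integrable `]a j, a j.+1[ (EFin \o k).
    by apply: integrable_kernel => //; exact: at_.
  have mk : mu.-integrable `]a j, a j.+1[ (EFin \o (fun s => m j * k s)).
    have := @bounded_integrableM _ _ _ mu _ (measurable_itv `]a j, a j.+1[)
      (fun=> m j) k `|m j|.
    by apply.
  have ek : mu.-integrable `]a j, a j.+1[ (EFin \o (fun s => (dy s - m j) * k s)).
    apply: (@bounded_integrableM _ _ _ mu _ (measurable_itv `]a j, a j.+1[) _ _ E) => //.
      exact: mdm.
    by move=> s; rewrite /= in_itv/=; exact: uE.
  have -> : \int[mu]_(s in `]a j, a j.+1[) (dy s * k s) =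
      \int[mu]_(s in `]a j, a j.+1[) (m j * k s + (dy s - m j) * k s).
    by apply: eq_Rintegral => s _; rewrite -mulrDl addrC subrK.
  rewrite RintegralD// RintegralZl// Rintegral_kernel//; last exact: at_.
  rewrite -/A -/(e j); congr (_ + _).
  have -> : t - a j = (n - j - 1).+1%:R * tau.
    by rewrite subn1 prednK ?subn_gt0// natrB ?(ltnW jn)// mulrBl.
  have -> : t - a j.+1 = (n - j - 1)%:R * tau.
    by rewrite -subnDA addn1 natrB// mulrBl.
  rewrite !powRM ?(ltW tau0)// taualpha /m /L1_coef.
  by field; rewrite gt_eqF.
rewrite (eq_big_nat _ _ (F2 := fun j => A * tau `^ (- alpha) *
  (L1_coef alpha (n - j - 1)%N * (y (a j.+1) - y (a j))) + e j)); last first.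
  by move=> j /andP[_ jn]; exact: cellE.
(* Here b_0 = 1 relies on [0 ^ (1 - alpha)] being 0, as 1 - alpha is not 0. *)
rewrite big_split/= -mulr_sumr (@L1_summation_by_parts _ (fun j => y (a j)))//; last first.
  by rewrite /L1_coef powR1 powR0 ?subr0// gt_eqF// subr_gt0.
rewrite /a mul0r -/a -/A -/t addrAC subrr add0r.
have kge s : 0 <= k s by exact: powR_ge0.
have ka : k (a n.-1) = tau `^ (- alpha).
  rewrite /k (_ : t = a n.-1.+1); last by rewrite prednK.
  by rewrite dA.
have elast : `|e n.-1| <= E * tau `^ (1 - alpha) * A.
  have n1n : (n.-1 < n)%N by rewrite prednK.
  have := kernel_cell_le al01 (aa n.-1) (at_ _ n1n) (mdm _ n1n) (fun s => @uE _ s n1n).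
  have -> : t - a n.-1 = tau by rewrite -(dA n.-1) prednK.
  have -> : t - a n.-1.+1 = 0 by rewrite prednK// subrr.
  by rewrite powR0 ?subr0 1?mulrCA 1?[A * _]mulrC ?mulrA// subr_eq0 gt_eqF.
have einit j : (j < n.-1)%N -> `|e j| <= E * tau * (k (a j.+1) - k (a j)).
  move=> jn1; have jn : (j < n)%N by rewrite (leq_trans jn1)// leq_pred.
  rewrite -(dA j); apply: kernel_cell_le_mean0 => //.
  - by rewrite ltr_pM2r// ltr_nat -(prednK n1) ltnS.
  - exact: mdm.
  - by move=> s; exact: uE.
  - rewrite RintegralB//.
    + rewrite (C1_Rintegral_derive1 C1y)//; last exact: le_trans (at_ _ jn) nT.
      rewrite Rintegral_cst//= lebesgue_measure_itv/= lte_fin aa -EFinD/= dA.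
      by rewrite /m divfK ?subrr// gt_eqF.
    + apply: (@integrable_bounded_itv _ _ M).
        exact: measurable_funS (cell j jn) mdy.
      by move=> s sj; apply: dyM; have := cell j jn s; rewrite /= !in_itv/=; exact.
    + by apply: (@integrable_bounded_itv _ _ `|m j|).
rewrite -(prednK n1) big_nat_recr//=.
apply: le_trans (ler_normD _ _) _.
rewrite mulrDr mulr1; apply: lerD => //.
apply: le_trans (ler_norm_sum _ _ _) _.
apply: le_trans (_ : \sum_(0 <= j < n.-1) E * tau * (k (a j.+1) - k (a j)) <= _).
  by rewrite !big_nat; apply: ler_sum => j /andP[_]; exact: einit.
rewrite -mulr_sumr telescope_sumr// ka taualpha mulrA ler_wpM2l//.
  by rewrite mulr_ge0// ltW.
by rewrite gerBl.
Qed.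

End L1Consistency.

(** * The error bound with its constant *)

Unset Implicit Arguments.
Set Strict Implicit.

Theorem corollary2 (R : realType) (alpha p T mu gamma : R)
    (halpha : 0 < alpha < 1) (hp : 1 < p) (hT : 0 < T)
    (hmu : 0 <= mu < p - 1) (hgamma : 0 <= gamma < p - 1) :
  let w := jacobi_weight T mu gamma in
  let nu := Num.max mu gamma in
  exists2 C : R, 0 < C &
    forall y : R -> R,
      in_weighted_Sobolev T w 2 p y -> C1_on_itv 0 T y ->
      forall N n : nat, (1 <= N)%N -> (1 <= n <= N)%N ->
        let tau := T / N%:R in
        `|caputo alpha y (n%:R * tau) - L1_scheme alpha tau y n|
          <= C * tau `^ (2 - alpha - (1 + nu) / p)
               * weighted_Sobolev_norm T w 2 p y.
Proof.
move=> w nu; have [K K0 HK] := derive1_modulus hp hT hmu hgamma.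
have /andP[alpha0 alpha1] := halpha.
pose G : R := (Gamma (1 - alpha))^-1.
pose A := (1 - alpha)^-1.
have A0 : 0 < A by rewrite invr_gt0 subr_gt0.
(* The summand 1 makes the constant positive whatever the value of [G]. *)
exists ((`|G| + 1) * (1 + A) * K).
  by rewrite !mulr_gt0// ltr_wpDl// ltW.
move=> y Sy C1y N n N1 /andP[n1 nN]; cbv zeta; set tau := T / N%:R.
have N0 : (0 : R) < N%:R by rewrite ltr0n.
have tau0 : 0 < tau by rewrite divr_gt0.
have tauT : tau <= T by rewrite ler_pdivrMr// ler_peMr ?ler1n// ltW.
have jT (j : nat) : (j <= N)%N -> j%:R * tau <= T.
  move=> jN; rewrite /tau mulrA ler_pdivrMr// mulrC ler_pM2l//.
  by rewrite ler_nat.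
set nm := weighted_Sobolev_norm T w 2 p y.
have nm0 : 0 <= nm by exact: powR_ge0.
pose E := K * tau `^ (1 - (1 + nu) / p) * nm.
have E0 : 0 <= E by rewrite !mulr_ge0 ?powR_ge0// ltW.
have cellE (j : nat) s s' : (j < n)%N -> j%:R * tau < s < j.+1%:R * tau ->
    j%:R * tau < s' < j.+1%:R * tau ->
    `|y^`()%classic s - y^`()%classic s'| <= E.
  move=> jn /andP[js sj] /andP[js' s'j].
  have j0 : 0 <= j%:R * tau by rewrite mulr_ge0// ltW.
  have jN := jT j.+1 (leq_trans jn nN).
  have jS : j.+1%:R * tau = j%:R * tau + tau by rewrite -natr1 mulrDl mul1r.
  apply: HK => //; [lra|lra|].
  by rewrite ler_norml; lra.
have := L1_consistency halpha tau0 n1 (jT n nN) E0 C1y cellE.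
have -> : caputo alpha y (n%:R * tau) - L1_scheme alpha tau y n =
    G * (\int[lebesgue_measure]_(s in `]0, n%:R * tau[)
           (y^`()%classic s / (n%:R * tau - s) `^ alpha)
   - A * tau `^ (- alpha) *
     (y (n%:R * tau) - L1_coef alpha n.-1 * y 0
      - \sum_(1 <= i < n) (L1_coef alpha (n - i - 1)%N - L1_coef alpha (n - i)%N)
          * y (i%:R * tau))).
  (* Gamma(2 - alpha) = (1 - alpha) Gamma(1 - alpha) extracts the common factor [G] and leaves the
     prefactor [A * tau ^ (- alpha)] of the consistency estimate. *)
  rewrite /caputo /L1_scheme (_ : 2 - alpha = (1 - alpha) + 1); last by ring.
  rewrite Gamma_rec ?subr_gt0// invfM -/G -/A; cbv zeta.
  by set I := Rintegral _ _ _; set S := _ - \sum_(1 <= i < n) _; ring.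
rewrite normrM; set X := `|_ - _|; move=> HX.
have X0 : 0 <= X by exact: normr_ge0.
have -> : tau `^ (2 - alpha - (1 + nu) / p) =
    tau `^ (1 - alpha) * tau `^ (1 - (1 + nu) / p).
  rewrite -powRD; last by rewrite (gt_eqF tau0) implybT.
  by congr (_ `^ _); ring.
apply: (@le_trans _ _ ((`|G| + 1) * (E * tau `^ (1 - alpha) * (1 + A)))).
  by apply: ler_pM => //; rewrite lerDl.
by rewrite le_eqVlt; apply/orP; left; apply/eqP; rewrite /E; ring.
Qed.
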